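(* Let $(E,\rho)$ be a Polish metric space and $\Psi$ an $E$-valued time-homogeneous Markov process with transition semigroup $\{P(t)\}_{t\geq 0}$. Let $V:E\to[0,\infty)$ be continuous and assume: (a) $\{P(t)\}$ has a unique invariant probability measure $\mu_*$, and there are $\gamma>0$ and $C:\{\nu\in\mathcal{M}_1(E):\int V\,d\nu<\infty\}\to[0,\infty)$ with $d_{\mathrm{FM}}(\nu P(t),\mu_* )\leq C(\nu)e^{-\gamma t}$ for all $t\geq0$ and such $\nu$, where $C(\delta_x)=\varkappa(V(x)+1)^{1/2}$ for some $\varkappa>0$; (b) there exist $A,B\geq 0$, $\Gamma>0$ with $P(t)V^2(x)\leq Ae^{-\Gamma t}V^2(x)+B$ for all $x,t$. Let $g\in\operatorname{Lip}_b(E)$ be such that for every $x\in E$ the map $t\mapsto P(t)g(x)$ is continuous in some neighbourhood of $0$. Let $\bar g=g-\int g\,d\mu_*$, $\chi(x)=\int_0^\infty P(t)\bar g(x)\,dt$, $M(1)=\chi(\Psi(1))-\chi(\Psi(0))+\int_0^1\bar g(\Psi(s))\,ds$ and $\sigma^2=\mathbb{E}_{\mu_*}(M(1)^2)$. Then $$\sigma^2=-2\int_E\chi\,\mathcal{A}\chi\,d\mu_*=2\int_E\chi\,\bar g\,d\mu_*,$$ where $\mathcal{A}$ is the infinitesimal generator defined in the context.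
   Context: $\mathcal{M}_1(E)$: Borel probability measures; $\operatorname{Lip}_b(E)$: bounded Lipschitz functions with $\|f\|_{\mathrm{BL}}=\max\{\|f\|_\infty,\sup_{x\neq y}|f(x)-f(y)|/\rho(x,y)\}$; $d_{\mathrm{FM}}(\mu,\nu)=\sup\{|\int f\,d\mu-\int f\,d\nu|:\|f\|_{\mathrm{BL}}\leq1\}$. $P(t)f(x)=\int f(y)P(t)(x,dy)$, $\nu P(t)=\int P(t)(x,\cdot)\nu(dx)$; $\mathbb{E}_{\mu_*}$ is expectation for the process with initial distribution $\mu_*$. Generator: let $\mathbb{L}$ be the space of Borel functions $f\in\mathcal{L}^2(\mu_* )$ such that $f^2$ is integrable with respect to $\delta_xP(t)$ for every $x\in E$ and $t\geq0$; let $\|f\|_2=(\int f^2\,d\mu_* )^{1/2}$; $\mathbb{L}_0=\{f\in\mathbb{L}:\lim_{t\to0^+}\|P(t)f-f\|_2=0\}$; $D_{\mathcal{A}}=\{f\in\mathbb{L}_0:\exists\hat f\in\mathbb{L}_0,\ \lim_{t\to0^+}\|(P(t)f-f)/t-\hat f\|_2=0\}$, and $\mathcal{A}f=\hat f$ (the $\|\cdot\|_2$-limit of $(P(t)f-f)/t$) for $f\in D_{\mathcal{A}}$. (In this setting $\chi\in D_{\mathcal{A}}$.) *)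

(* Defs.v *)
From HB Require Import structures.
From mathcomp Require Import all_boot all_order all_algebra.
From mathcomp Require Import all_classical all_reals all_analysis.
Set Implicit Arguments. Unset Strict Implicit. Unset Printing Implicit Defensive.
Import Order.TTheory GRing.Theory Num.Theory.
Import numFieldNormedType.Exports.
Local Open Scope classical_set_scope.
Local Open Scope ring_scope.

Section Defs.
Context (R : realType).

Section Metric.
Context {T : Type} (rho : T -> T -> R).

Definition is_metric : Prop :=
  [/\ forall x y, 0 <= rho x y,
      forall x y, rho x y = 0 <-> x = y,
      forall x y, rho x y = rho y x &
      forall x y z, rho x z <= rho x y + rho y z].

Definition rho_open (U : set T) : Prop :=
  forall x, U x -> exists2 e : R, 0 < e & [set y | rho x y < e] `<=` U.

Definition rho_cauchy (u : nat -> T) : Prop :=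
  forall e : R, 0 < e -> exists N, forall m n, (N <= m)%N -> (N <= n)%N ->
    rho (u m) (u n) < e.

Definition rho_converges (u : nat -> T) (l : T) : Prop :=
  forall e : R, 0 < e -> exists N, forall n, (N <= n)%N -> rho (u n) l < e.

Definition rho_complete : Prop :=
  forall u, rho_cauchy u -> exists l, rho_converges u l.

Definition rho_separable : Prop :=
  exists D : nat -> T, forall x (e : R), 0 < e -> exists n, rho x (D n) < e.

Definition polish_metric : Prop := [/\ is_metric, rho_complete & rho_separable].

Definition rho_continuous (f : T -> R) : Prop :=
  forall x (e : R), 0 < e -> exists2 d : R, 0 < d &
    forall y, rho x y < d -> `|f x - f y| < e.

Definition lip_b (f : T -> R) : Prop :=
  exists L : R, (forall x, `|f x| <= L) /\ (forall x y, `|f x - f y| <= L * rho x y).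

Definition BL1 (f : T -> R) : Prop :=
  (forall x, `|f x| <= 1) /\ (forall x y, `|f x - f y| <= rho x y).
End Metric.

Context {d : measure_display} {E : measurableType d}.

Definition borel_of (rho : E -> E -> R) : Prop :=
  (@measurable d E) = <<s rho_open rho >>.

Definition dFM (rho : E -> E -> R)
  (mu' : {measure set E -> \bar R}) (nu' : {measure set E -> \bar R}) : \bar R :=
  ereal_sup ((fun f => `| integral mu' setT (fun x => (f x)%:E)
                         - integral nu' setT (fun x => (f x)%:E) |%E)
             @` [set f | BL1 rho f]).

Definition is_mix (nu : {measure set E -> \bar R}) (k : R.-pker E ~> E)
   (nuP : set E -> \bar R) : Prop :=
  forall A, measurable A -> nuP A = integral nu setT (fun x => k x A).

Definition transition_semigroup (P : R -> R.-pker E ~> E) : Prop :=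
  (forall x A, measurable A -> P 0 x A = \d_x A) /\
  (forall s t x A, 0 <= s -> 0 <= t -> measurable A ->
     P (s + t) x A = integral (P s x) setT (fun y => P t y A)).

Definition Pf (P : R -> R.-pker E ~> E) (t : R) (f : E -> R) (x : E) : R :=
  Rintegral (P t x) setT f.

(* iterated kernel integral for finite-dimensional distributions:
   steps = [:: (h1, A1); ...; (hn, An)], time increments and target sets *)
Fixpoint chain (P : R -> R.-pker E ~> E) (x : E) (steps : seq (R * set E))
  : \bar R :=
  match steps with
  | [::] => 1%E
  | (h, A) :: r => integral (P h x) A (fun y => chain P y r)
  end.

Fixpoint hits {Om : Type} (Psi : R -> Om -> E) (t : R) (steps : seq (R * set E))
  (w : Om) : Prop :=
  match steps with
  | [::] => True
  | (h, A) :: r => A (Psi (t + h) w) /\ hits Psi (t + h) r w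
  end.

(* Psi is a (jointly measurable) time-homogeneous Markov process on (Om, Pr),
   with respect to its natural filtration, with transition semigroup P:
   finite-dimensional distributions are given by P. *)
Definition markov_process {dO : measure_display} {Om : measurableType dO}
  (Pr : probability Om R) (Psi : R -> Om -> E) (P : R -> R.-pker E ~> E) : Prop :=
  [/\ transition_semigroup P,
      (forall t, 0 <= t -> measurable_fun setT (Psi t)),
      measurable_fun (setT `*` `[(0:R), +oo[) (fun p : Om * R => Psi p.2 p.1) &
      (forall t0 (A0 : set E) (steps : seq (R * set E)),
         0 <= t0 -> measurable A0 ->
         all (fun p => 0 <= p.1) steps ->
         (forall p, p \in steps -> measurable p.2) ->
         Pr [set w | A0 (Psi t0 w) /\ hits Psi t0 steps w]
         = integral Pr setT (fun w => ((\1_A0 (Psi t0 w))%:E * chain P (Psi t0 w) steps)%E))].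

Definition l2norm (mu : {measure set E -> \bar R}) (f : E -> R) : R :=
  Num.sqrt (fine (integral mu setT (fun x => (f x ^+ 2)%:E))).

Definition LL (mu : {measure set E -> \bar R}) (P : R -> R.-pker E ~> E)
  (f : E -> R) : Prop :=
  [/\ measurable_fun setT f,
      (integral mu setT (fun x => (f x ^+ 2)%:E) < +oo)%E &
      forall x t, 0 <= t -> (integral (P t x) setT (fun y => (f y ^+ 2)%:E) < +oo)%E].

Definition LL0 (mu : {measure set E -> \bar R}) (P : R -> R.-pker E ~> E)
  (f : E -> R) : Prop :=
  LL mu P f /\
  (fun t => l2norm mu (fun x => Pf P t f x - f x)) @ 0^'+ --> 0.

Definition gen_value (mu : {measure set E -> \bar R}) (P : R -> R.-pker E ~> E)
  (f hf : E -> R) : Prop :=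
  [/\ LL0 mu P f, LL0 mu P hf &
      (fun t => l2norm mu (fun x => (Pf P t f x - f x) / t - hf x)) @ 0^'+ --> 0].

End Defs.

(* Main.v *)
Require Import Defs.
From HB Require Import structures.
From mathcomp Require Import all_boot all_order all_algebra.
From mathcomp Require Import all_classical all_reals all_analysis.
From mathcomp Require Import measurable_realfun giry.
From mathcomp Require Import ring lra.
Set Implicit Arguments. Unset Strict Implicit. Unset Printing Implicit Defensive.
Import Order.TTheory GRing.Theory Num.Theory.
Import numFieldNormedType.Exports.
Local Open Scope classical_set_scope.
Local Open Scope ring_scope.

(** Write [G t x = P(t) gbar x].  Exponential ergodicity gives
    [|G t x| <= const * sqrt (V x + 1) * exp (- gamma t)], and (b) with the
    invariance of [mu] gives [\int V^2 dmu <= B], so that [chi] is in [L^2(mu)].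
    By Fubini and the semigroup property,
    [P(s) chi = chi - \int_0^s G u du]; as [G u -> gbar] boundedly when
    [u -> 0+], the generator maps [chi] to [- gbar].
    For the variance put [X = chi (Psi 1)], [Y = chi (Psi 0)],
    [b s = gbar (Psi s)], [I = \int_0^1 b s ds] and
    [rho u = \int gbar * G u dmu].  By stationarity [E[X^2] = E[Y^2]], and the
    Markov property gives [E[Y (X + I)] = E[Y^2]], hence
    [E[(X - Y + I)^2] = 2 E[X I] + E[I^2]].  Finally
    [E[X b s] = \int chi gbar dmu - \int_s^1 rho (r - s) dr] and
    [E[I b s] = \int_s^1 rho (r - s) dr + \int_0^s rho (s - r) dr], where the last
    two integrals have the same integral over [s] in [[0, 1]]. *)

(** * Integrals of real-valued functions *)

(** The square root in [C (\d_x)] and the square in (b) fit together: the dominating function [w]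
    satisfies [w^2 = const * (V + 1) <= const * (V^2 + 2)], so [chi] is square integrable under [mu]
    and also under every [P t x], as membership in [LL] demands. Time regularity enters as the right
    limit of [P(t) gbar x] at 0. The semigroup property carries it to right continuity at every
    time, and this yields the joint measurability in [(x, t)] on which the Fubini arguments for [G]
    rest. [Rintegral] and [l2norm] take default values outside integrable functions, so each
    identity travels with integrability proofs; those for iterated integrals come from a product
    bound [|F x s| <= h x * c s]. No conditional expectation is formed: the law of
    [(Psi s, Psi (s + h))] is [mu(dx) P h x (dy)], which turns expectations of products into
    integrals against [mu]. The identity for [E[Y (X + I)]] is the martingale property tested
    against [Y]. The generator determines its value only up to a [mu]-null set, hence the statement
    about every [hchi]. *)

Section ProductIntegral.
Context {R : realType} {d : measure_display} {X : measurableType d}.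
Notation leb := (@lebesgue_measure R).
Variables (m : {sigma_finite_measure set X -> \bar R}) (D : set (measurableTypeR R)).
Variables (F : X -> R -> R) (h : X -> R) (c : R -> R).
Hypothesis mD : measurable D.
Hypothesis mF : measurable_fun (setT `*` D) (fun p : X * measurableTypeR R => F p.1 p.2).
Hypothesis Fle : forall x s, D s -> `|F x s| <= h x * c s.
Hypothesis ih : m.-integrable setT (EFin \o h).
Hypothesis ic : leb.-integrable D (EFin \o c).

(** Extension of [F] by 0 outside [D]: Fubini is then applied on the full product space. *)
Let f (p : X * measurableTypeR R) : \bar R := (((F p.1) \_ D) p.2)%:E.

Let mf : measurable_fun setT f.
Proof.
apply/measurable_EFinP.
have -> : (fun p : X * measurableTypeR R => ((F p.1) \_ D) p.2) =
          (fun p : X * measurableTypeR R => F p.1 p.2) \_ (setT `*` D).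
  by apply/funext => -[x s]; rewrite /patch in_setX in_setT.
apply/(measurable_restrictT _ _).1 => //; exact: measurableX.
Qed.

Let mfx x : measurable_fun setT (fun s => f (x, s)).
Proof. by apply: measurableT_comp => //; exact: pair1_measurable. Qed.

Lemma measurable_section x : measurable_fun D (F x).
Proof.
have /measurable_EFinP H := mfx x.
by apply/(measurable_restrictT _ _).2.
Qed.

Lemma integrable_section x : leb.-integrable D (EFin \o F x).
Proof.
have := integrableZl mD (h x) ic; apply: (le_integrable mD).
  by apply/measurable_EFinP; exact: measurable_section.
move=> s Ds /=; rewrite lee_fin; apply: (le_trans (Fle x Ds)).
exact: ler_norm.
Qed.

Lemma integrable_section2 s : D s -> m.-integrable setT (EFin \o F^~ s).
Proof.
move=> Ds; have := integrableZl measurableT (c s) ih; apply: (le_integrable measurableT).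
  have : measurable_fun setT (fun x => f (x, s)).
    by apply: measurableT_comp => //; exact: pair2_measurable.
  apply: eq_measurable_fun => x _; rewrite /f /patch /= ifT//; exact: mem_set.
move=> x _ /=; rewrite lee_fin; apply: (le_trans (Fle x Ds)).
rewrite mulrC; exact: ler_norm.
Qed.

(** Tonelli for [|f|]: the inner integral is at most [|h x|] times the finite integral of [|c|] over
    [D]. *)
Let fint : (m \x leb)%E.-integrable setT f.
Proof.
apply/(integrable12ltyP _ _ mf).
apply: (@le_lt_trans _ _ (\int[m]_x ((`|h x|)%:E * (\int[leb]_(s in D) `|(c s)%:E|)))%E).
  apply: ge0_le_integral => //.
  - by move=> x _; apply: integral_ge0.
  - apply: (measurable_fun_fubini_tonelli_F (abse \o f)) => //=.
    exact: measurableT_comp.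
  - apply: emeasurable_funM => //; apply/measurable_EFinP/measurableT_comp => //.
    by have /measurable_EFinP := measurable_int _ ih.
  - move=> x _; rewrite -ge0_integralZl//; last first.
      by apply: measurableT_comp => //; exact: measurable_int ic.
    rewrite (integral_mkcond D); apply: ge0_le_integral => //.
    + exact: measurableT_comp (mfx x).
    + apply/(measurable_restrictT _ _).1 => //; apply: measurable_funeM.
      by apply: measurableT_comp => //; exact: measurable_int ic.
    + move=> s _; rewrite /f /patch /=; case: ifPn => sD; last by rewrite normr0.
      rewrite -EFinM lee_fin -normrM.
      apply: (le_trans (Fle x (set_mem sD))); exact: ler_norm.
have [_ icoo] := integrableP _ _ _ ic.
have [_ ihoo] := integrableP _ _ _ ih.
have icf : (\int[leb]_(s in D) `|(c s)%:E|)%E \is a fin_num.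
  by rewrite ge0_fin_numE//; apply: integral_ge0.
rewrite -(fineK icf) integralZr//; last exact: (integrable_norm ih).
rewrite lte_mul_pinfty//.
- by apply: integral_ge0.
- by rewrite ge0_fin_numE//; apply: integral_ge0.
- by rewrite ltry.
Qed.

Let FE x : fubini_F leb f x = (\int[leb]_(s in D) F x s)%:E.
Proof.
rewrite /fubini_F /Rintegral fineK; last first.
  exact: integrable_fin_num (integrable_section x).
rewrite (integral_mkcond D); apply: eq_integral => s _.
by rewrite /f /patch /=; case: ifP.
Qed.

Let GE s : fubini_G m f s = ((EFin \o fun s => \int[m]_x F x s) \_ D) s.
Proof.
rewrite /fubini_G /patch; case: ifPn => sD.
  rewrite /= /Rintegral fineK; last first.
    by apply: integrable_fin_num => //; exact: integrable_section2 (set_mem sD).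
  by apply: eq_integral => x _; rewrite /f /patch /= sD.
by apply: integral0_eq => x _; rewrite /f /patch /= (negbTE sD).
Qed.

Lemma integrable_Rintegral1 :
  m.-integrable setT (EFin \o fun x => \int[leb]_(s in D) F x s).
Proof.
have := integrable_fubini_F fint; apply: eq_integrable => // x _; exact: FE.
Qed.

Lemma integrable_Rintegral2 :
  leb.-integrable D (EFin \o fun s => \int[m]_x F x s).
Proof.
have := integrableZl mD (\int[m]_x h x) ic; apply: (le_integrable mD).
  apply: (@eq_measurable_fun _ _ _ _ _ (fubini_G m f)) => [s sD|].
    by rewrite GE /patch sD.
  by apply: (measurable_funS measurableT) => //; exact: (measurable_fubini_G fint).
move=> s Ds /=; rewrite lee_fin.
apply: (le_trans (le_normr_Rintegral measurableT (integrable_section2 Ds))).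
apply: le_trans (ler_norm _); rewrite -RintegralZr//.
apply: le_Rintegral => //.
- exact/integrable_norm/integrable_section2.
- apply: (eq_integrable _ _ _ _ (integrableZl measurableT (c s) ih)) => // x _ /=.
  by rewrite mulrC.
- by move=> x _; exact: Fle.
Qed.

Lemma Rintegral_swap :
  \int[m]_x (\int[leb]_(s in D) F x s) = \int[leb]_(s in D) (\int[m]_x F x s).
Proof.
have -> : \int[m]_x (\int[leb]_(s in D) F x s) = fine (\int[m]_x fubini_F leb f x)%E.
  by congr fine; apply: eq_integral => x _; rewrite FE.
rewrite integral12_prod_meas1// -integral21_prod_meas1//.
rewrite /Rintegral (integral_mkcond D); congr fine.
by apply: eq_integral => s _; exact: GE.
Qed.

End ProductIntegral.

Section Shift.
Context {R : realType}.
Notation leb := (@lebesgue_measure R).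

(** Lebesgue measure is determined by its values on the intervals []x, y]], and the preimage of such
    an interval under a translation is one of the same length. *)
Lemma lebesgue_measure_shift (a : R) (A : set R) : measurable A ->
  pushforward leb (+%R a : _ -> measurableTypeR R) A = leb A.
Proof.
have mphi : measurable_fun setT (+%R a : measurableTypeR R -> measurableTypeR R).
  exact: measurable_funD.
move=> mA; apply/esym/lebesgue_measure_unique => //= _ [[x y]] _ <-.
rewrite /pushforward/=.
have -> : +%R a @^-1` `]x, y] = `](x - a), (y - a)]%classic.
  by apply/seteqP; split=> t /=; rewrite !in_itv/= ltrBlDl lerBrDl.
rewrite !lebesgue_measure_itv/= !lte_fin ltrD2r; case: ifPn => // _.
by congr EFin; ring.
Qed.

Lemma Rintegral_shift (a : R) (D : set (measurableTypeR R)) (f : R -> R) : measurable D ->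
  leb.-integrable D (EFin \o f) ->
  \int[leb]_(x in +%R a @^-1` D) f (a + x) = \int[leb]_(x in D) f x.
Proof.
move=> mD fi.
have mphi : measurable_fun setT (+%R a : measurableTypeR R -> measurableTypeR R).
  exact: measurable_funD.
have fDi := (integrable_mkcond _ mD).1 fi.
have mfD := measurable_int _ fDi.
have leb_a A : measurable A -> A `<=` setT -> pushforward leb (+%R a : _ -> measurableTypeR R) A = leb A.
  by move=> mA _; exact: lebesgue_measure_shift.
have mpD : measurable (+%R a @^-1` D : set (measurableTypeR R)).
  by rewrite -[X in measurable X]setTI; exact: mphi.
have ifa : leb.-integrable (+%R a @^-1` setT) (((EFin \o f) \_ D) \o +%R a).
  apply/integrableP; split; first by apply: measurableT_comp.
  have [_] := integrableP _ _ _ fDi; rewrite -(eq_measure_integral _ leb_a).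
  by rewrite ge0_integral_pushforward//; exact: measurableT_comp.
rewrite /Rintegral (integral_mkcond D) -(eq_measure_integral _ leb_a).
have -> := integral_pushforward mphi mfD ifa measurableT.
by rewrite preimage_setT integral_mkcond.
Qed.

End Shift.

(** * Kernels as points of the Giry monad *)

Section Mixture.
Context {R : realType} {d1 d2 : measure_display}.
Context {X : measurableType d1} {Z : measurableType d2}.
Variables (nu : giry X R) (K : X -> giry Z R).
Variable m : {measure set Z -> \bar R}.
Hypothesis mK : measurable_fun setT K.
Hypothesis mE : forall A, measurable A -> m A = (\int[nu]_x K x A)%E.

Lemma ge0_integral_mixture (f : Z -> \bar R) :
  measurable_fun setT f -> (forall z, 0 <= f z)%E ->
  (\int[m]_z f z = \int[nu]_x \int[K x]_z f z)%E.
Proof.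
move=> mf f0.
transitivity (\int[giry_bind nu mK]_z f z)%E.
  apply: eq_measure_integral => A mA _; rewrite mE//.
  by rewrite /giry_bind /= giry_int_map//; exact: measurable_giry_ev.
exact: giry_int_bind.
Qed.

Lemma measurable_integral_mixture (f : Z -> \bar R) :
  measurable_fun setT f -> (forall z, 0 <= f z)%E ->
  measurable_fun setT (fun x => \int[K x]_z f z)%E.
Proof.
move=> mf f0.
exact: measurableT_comp (measurable_giry_int mf f0) mK.
Qed.

Variable f : Z -> R.
Hypothesis fm : m.-integrable setT (EFin \o f).
Hypothesis fK : forall x, (K x).-integrable setT (EFin \o f).

Let mf : measurable_fun setT (EFin \o f). Proof. exact: measurable_int fm. Qed.
Let mfp := measurable_funepos mf.
Let mfn := measurable_funeneg mf.

Let ip : nu.-integrable setT (fun x => \int[K x]_z (EFin \o f)^\+ z)%E.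
Proof.
apply/integrableP; split; first exact: measurable_integral_mixture.
under eq_integral do rewrite gee0_abs ?integral_ge0//.
by rewrite -ge0_integral_mixture//; exact: integral_funepos_lt_pinfty.
Qed.

Let in_ : nu.-integrable setT (fun x => \int[K x]_z (EFin \o f)^\- z)%E.
Proof.
apply/integrableP; split; first exact: measurable_integral_mixture.
under eq_integral do rewrite gee0_abs ?integral_ge0//.
by rewrite -ge0_integral_mixture//; exact: integral_funeneg_lt_pinfty.
Qed.

Let RE x : (\int[K x]_z f z)%:E =
  (\int[K x]_z (EFin \o f)^\+ z - \int[K x]_z (EFin \o f)^\- z)%E.
Proof.
rewrite -[RHS]integralE /Rintegral fineK//; exact: integrable_fin_num (fK x).
Qed.

Lemma integrable_mixture :
  nu.-integrable setT (EFin \o fun x => \int[K x]_z f z).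
Proof.
apply: (eq_integrable _ _ _ _ (integrableB measurableT ip in_)) => // x _ /=.
by rewrite RE.
Qed.

(** The nonnegative case applied to both parts of [f]; [fK] makes the inner difference finite, so it
    agrees with the real-valued integral at every [x]. *)
Lemma Rintegral_mixture : \int[m]_z f z = \int[nu]_x \int[K x]_z f z.
Proof.
rewrite /Rintegral; congr fine; under [RHS]eq_integral do rewrite RE.
by rewrite integralB// -!ge0_integral_mixture// -integralE.
Qed.

End Mixture.

Section Kernel.
Context {R : realType} {d1 d2 : measure_display}.
Context {X : measurableType d1} {Y : measurableType d2}.
Variable k : R.-pker X ~> Y.

(** A copy of [k x] to which the bound on the total mass can be attached: the points of [giry] are
    subprobability measures. *)
Definition kernel_measure (x : X) : set Y -> \bar R := k x.

HB.instance Definition _ x := Measure.on (kernel_measure x).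

Let kernel_measure_setT x : (kernel_measure x setT <= 1)%E.
Proof. by rewrite /kernel_measure prob_kernel. Qed.

HB.instance Definition _ x :=
  Measure_isSubProbability.Build _ _ _ (kernel_measure x) (kernel_measure_setT x).

Definition giry_of_kernel (x : X) : giry Y R := kernel_measure x.

Lemma measurable_giry_of_kernel : measurable_fun setT giry_of_kernel.
Proof.
apply: measurable_giry_codensity => // B mB; exact: measurable_kernel.
Qed.

Section OneStep.
Variables (nu : giry X R) (m : {measure set Y -> \bar R}).
Hypothesis mE : forall A, measurable A -> m A = (\int[nu]_x k x A)%E.

Lemma Rintegral_kernel (f : Y -> R) : m.-integrable setT (EFin \o f) ->
  (forall x, (k x).-integrable setT (EFin \o f)) ->
  \int[m]_z f z = \int[nu]_x \int[k x]_z f z.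
Proof.
exact: (@Rintegral_mixture _ _ _ _ _ nu giry_of_kernel m measurable_giry_of_kernel mE).
Qed.

Lemma integrable_kernel (f : Y -> R) : m.-integrable setT (EFin \o f) ->
  (forall x, (k x).-integrable setT (EFin \o f)) ->
  nu.-integrable setT (EFin \o fun x => \int[k x]_z f z).
Proof.
exact: (@integrable_mixture _ _ _ _ _ nu giry_of_kernel m measurable_giry_of_kernel mE).
Qed.
End OneStep.

(** Default values do no harm here: the integral is [fine] of a difference of two measurable
    functions of [x]. *)
Lemma measurable_Rintegral_kernel (f : Y -> R) : measurable_fun setT f ->
  measurable_fun setT (fun x => \int[k x]_z f z).
Proof.
move=> mf; have mf' : measurable_fun setT (EFin \o f) by exact/measurable_EFinP.
have -> : (fun x => \int[k x]_z f z) =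
   (fun x => fine (\int[k x]_z (EFin \o f)^\+ z - \int[k x]_z (EFin \o f)^\- z))%E.
  by apply/funext => x; rewrite /Rintegral integralE.
apply: measurableT_comp => //; apply: emeasurable_funB.
- apply: measurable_fun_integral_kernel => //; first exact: measurable_kernel.
  exact: measurable_funepos.
- apply: measurable_fun_integral_kernel => //; first exact: measurable_kernel.
  exact: measurable_funeneg.
Qed.

Section Pair.
Context {dO : measure_display} {Om : measurableType dO}.
Variables (Pr : probability Om R) (nu : probability X R).
Variables (U : Om -> X) (W : Om -> Y).
Hypotheses (mU : measurable_fun setT U) (mW : measurable_fun setT W).
Hypothesis UW : forall A B, measurable A -> measurable B ->
  Pr (U @^-1` A `&` W @^-1` B) = (\int[nu]_(x in A) k x B)%E.

(** The product of [\d_x] and [k x], as the image of [k x] under [y |-> (x, y)]. The law of [(U, W)]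
    is the mixture of these measures over [nu]. *)
Let K x := giry_map (pair1_measurable x) (giry_of_kernel x).

Let KE x A : K x A = k x (xsection A x).
Proof. by rewrite xsectionE. Qed.

Let mK : measurable_fun setT K.
Proof.
apply: measurable_giry_codensity => // B mB.
have -> : (K^~ B) = (fun x => k x (xsection B x)) by apply/funext => x; exact: KE.
by apply: measurable_fun_xsection_finite_kernel; exact/mem_set.
Qed.

Let mUW : measurable_fun setT (fun w => (U w, W w)).
Proof. exact: measurable_fun_pair. Qed.

Let law : giry (X * Y)%type R := giry_map mUW Pr.

Let lawE A : measurable A -> law A = (\int[nu]_x K x A)%E.
Proof.
pose nu' : giry X R := nu.
move=> mA; transitivity (giry_bind nu' mK A); last first.
  by rewrite /giry_bind /= giry_int_map//; exact: measurable_giry_ev.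
(* Measurable rectangles are stable under intersection and generate the product sigma-algebra; on
   them the equality is [UW]. *)
apply: (measure_unique [set A `*` B | A in measurable & B in measurable] (fun=> setT)) => //.
- exact: measurable_prod_measurableType.
- move=> _ _ [A1 mA1 [B1 mB1 <-]] [A2 mA2 [B2 mB2 <-]].
  exists (A1 `&` A2); first exact: measurableI.
  by exists (B1 `&` B2); [exact: measurableI|rewrite setXI].
- by move=> _; exists setT => //; exists setT => //; rewrite setXTT.
- by rewrite bigcup_const.
- move=> _ [A1 mA1 [B1 mB1 <-]].
  rewrite /giry_bind /= giry_int_map//; last first.
    by apply: measurable_giry_ev; exact: measurableX.
  transitivity (Pr (U @^-1` A1 `&` W @^-1` B1)) => //.
  rewrite UW// /giry_int integral_mkcond; apply: eq_integral => x _ /=.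
  rewrite /giry_ev KE /patch; case: ifPn => xA.
    by rewrite in_xsectionX.
  by rewrite notin_xsectionX// measure0.
- move=> _; apply: (@le_lt_trans _ _ 1%E); last exact: ltry.
  exact: (@sprobability_setT _ _ _ law).
Qed.

Lemma Rintegral_pair (f : X -> R) (q : Y -> R) :
  measurable_fun setT f -> measurable_fun setT q ->
  Pr.-integrable setT (EFin \o fun w => f (U w) * q (W w)) ->
  (forall x, (k x).-integrable setT (EFin \o q)) ->
  \int[Pr]_w (f (U w) * q (W w)) = \int[nu]_x (f x * \int[k x]_y q y).
Proof.
move=> mf mq fq qk.
pose H (p : X * Y) := f p.1 * q p.2.
have mH : measurable_fun setT (EFin \o H).
  by apply/measurable_EFinP; apply: measurable_funM; exact: measurableT_comp.
have Hlaw : law.-integrable setT (EFin \o H).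
  exact: (@integrable_pushforward _ _ _ _ _ _ mUW Pr).
have HK x : (K x).-integrable setT (EFin \o H).
  apply: (@integrable_pushforward _ _ _ _ _ _ (pair1_measurable x) (k x)) => //.
  exact: (integrableZl measurableT (f x) (qk x)).
transitivity (\int[law]_p H p).
  by rewrite /Rintegral (@integral_pushforward _ _ _ _ _ _ mUW Pr).
pose nu' : giry X R := nu.
rewrite (@Rintegral_mixture _ _ _ _ _ nu' K law mK lawE)//.
apply: eq_Rintegral => x _; rewrite -RintegralZl//.
rewrite /Rintegral (@integral_pushforward _ _ _ _ _ _ (pair1_measurable x) (k x))//.
exact: (integrableZl measurableT (f x) (qk x)).
Qed.
End Pair.

End Kernel.

(** * Convergence, measurability and integrability lemmas *)

Section Law.
Context {R : realType} {d dO : measure_display}.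
Context {X : measurableType d} {Om : measurableType dO}.
Variables (Pr : probability Om R) (nu : probability X R) (U : Om -> X).
Hypothesis mU : measurable_fun setT U.
Hypothesis PU : forall A, measurable A -> Pr (U @^-1` A) = nu A.

Lemma integrable_law (f : X -> R) : nu.-integrable setT (EFin \o f) ->
  Pr.-integrable setT (EFin \o (f \o U)).
Proof.
move=> /integrableP[mf foo]; apply/integrableP; split; first exact: (measurableT_comp mf mU).
have mf' : measurable_fun setT (abse \o (EFin \o f)) by exact: (measurableT_comp _ mf).
have := ge0_integral_pushforward mU Pr measurableT mf'.
move=> /(_ (fun _ _ => abse_ge0 _)) /= <-.
by rewrite (eq_measure_integral nu)// => A mA _; exact: PU.
Qed.

Lemma Rintegral_law (f : X -> R) : nu.-integrable setT (EFin \o f) ->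
  \int[Pr]_w f (U w) = \int[nu]_x f x.
Proof.
move=> fi; have mf := measurable_int _ fi.
have := integral_pushforward mU mf (integrable_law fi) measurableT.
rewrite /Rintegral => /= <-; congr fine.
by apply: eq_measure_integral => A mA _; exact: PU.
Qed.
End Law.

Lemma Rintegral_dominated_cvg {R : realType} {d : measure_display}
    {X : measurableType d} (m : {measure set X -> \bar R})
    (f_ : nat -> X -> R) (f g : X -> R) :
  (forall n, measurable_fun setT (f_ n)) -> m.-integrable setT (EFin \o g) ->
  (forall n x, `|f_ n x| <= g x) -> (forall x, f_ n x @[n --> \oo] --> f x) ->
  \int[m]_x f_ n x @[n --> \oo] --> \int[m]_x f x.
Proof.
move=> mf_ gi fg ff.
have mf : measurable_fun setT f by apply: measurable_fun_cvg mf_ _ => x _; exact: ff.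
have [fi _ cv] : [/\ m.-integrable setT (EFin \o f), True &
   (\int[m]_x (f_ n x)%:E)%E @[n --> \oo] --> (\int[m]_x (f x)%:E)%E].
  have [||||| + _ +] := @dominated_convergence _ _ _ m _ measurableT
    (fun n => EFin \o f_ n) (EFin \o f) (EFin \o g).
  - by move=> n; exact/measurable_EFinP.
  - exact/measurable_EFinP.
  - by apply/aeW => x _; apply: cvg_EFin; [exact: nearW|exact: ff].
  - exact: gi.
  - by apply/aeW => x n _ /=; rewrite lee_fin.
  - by [].
apply: fine_cvg; rewrite /Rintegral fineK//.
exact: integrable_fin_num.
Qed.

Lemma measurable_right_continuous {R : realType} {d : measure_display}
    {X : measurableType d} (F : X -> R -> R) :
  (forall t, 0 <= t -> measurable_fun setT (F^~ t)) ->
  (forall x t (u : nat -> R), 0 <= t -> (forall n, t < u n) ->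
     u n @[n --> \oo] --> t -> F x (u n) @[n --> \oo] --> F x t) ->
  measurable_fun (setT `*` `[(0:R), +oo[) (fun p : X * R => F p.1 p.2).
Proof.
move=> mF rF.
(* [F x t] is the limit of [F x (a n t)], where [a n t > t] is a grid point. *)
pose a (n : nat) (t : R) : R := (Num.truncn (t * n.+1%:R)).+1%:R / n.+1%:R.
have n1 (n : nat) : 0 < n.+1%:R :> R by rewrite ltr0n.
have aE n t : 0 <= t -> t < a n t <= t + n.+1%:R^-1.
  move=> t0; have /andP[H1 H2] := truncn_itv (mulr_ge0 t0 (ltW (n1 n))).
  rewrite /a ltr_pdivlMr// H2 /=.
  by rewrite ler_pdivrMr// mulrDl mulVf ?gt_eqF// -natr1 lerD2r.
apply: (@measurable_fun_cvg _ _ _ _ (fun n p => F p.1 (a n p.2))).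
  move=> n mD B mB.
  pose J k : set R := `[k%:R / n.+1%:R, k.+1%:R / n.+1%:R[%classic.
  (* On the cell [J k] the grid time is constantly [k.+1 / n.+1], so the preimage is a countable
     union of measurable rectangles. *)
  suff -> : (setT `*` `[(0:R), +oo[) `&` (fun p : X * R => F p.1 (a n p.2)) @^-1` B
      = \bigcup_k ((F^~ (k.+1%:R / n.+1%:R) @^-1` B) `*` J k).
    apply: bigcup_measurable => k _; apply: measurableX.
      have kn0 : 0 <= k.+1%:R / n.+1%:R :> R by rewrite divr_ge0.
      by rewrite -[X in measurable X]setTI; exact: mF.
    exact: measurable_itv.
  apply/seteqP; split => -[x t] /=.
    move=> [[_]]; rewrite in_itv/= andbT => t0 FB.
    exists (Num.truncn (t * n.+1%:R)) => //; split => //=.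
    have /andP[H1 H2] := truncn_itv (mulr_ge0 t0 (ltW (n1 n))).
    by rewrite /J /= in_itv/= ler_pdivrMr// H1 ltr_pdivlMr// H2.
  move=> [k _ /= [FB]]; rewrite /J /= !in_itv/= ler_pdivrMr// ltr_pdivlMr// => kt.
  have t0 : 0 <= t.
    case/andP: kt => kt _; rewrite -(pmulr_lge0 _ (n1 n)); exact: le_trans kt.
  by rewrite t0; split => //; rewrite /a (truncn_def kt).
move=> [x t] /= [_]; rewrite in_itv/= andbT => t0; apply: rF => //.
  by move=> n; case/andP: (aE n t t0).
apply: (@squeeze_cvgr _ _ _ _ (cst t) (fun n => t + n.+1%:R^-1)).
- by apply: nearW => n; case/andP: (aE n t t0) => /ltW -> ->.
- exact: cvg_cst.
- rewrite -[X in _ --> X]addr0; apply: cvgD; first exact: cvg_cst.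
  exact: cvg_harmonic.
Qed.

(** * Integrability under a measure of total mass one *)

Section Finite.
Context {R : realType} {d : measure_display} {X : measurableType d}.
Variable m : {measure set X -> \bar R}.
Hypothesis m1 : m setT = 1%E.

(** The mass condition is an equation on a plain measure so that [P t x] qualifies alongside [mu]
    and [Pr]. *)
Lemma bounded_integrable (f : X -> R) (M : R) : measurable_fun setT f ->
  (forall x, `|f x| <= M) -> m.-integrable setT (EFin \o f).
Proof.
move=> mf fM; apply: measurable_bounded_integrable => //; first by rewrite m1 ltry.
exists M; split; first exact: num_real.
by move=> M' MM' x _; exact: le_trans (fM x) (ltW MM').
Qed.

Lemma normr_Rintegral_le (f : X -> R) (M : R) : measurable_fun setT f ->
  (forall x, `|f x| <= M) -> `|\int[m]_x f x| <= M.
Proof.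
move=> mf fM; have fi := bounded_integrable mf fM.
apply: (le_trans (le_normr_Rintegral measurableT fi)).
have cM : m.-integrable setT (EFin \o cst M).
  by apply: (@bounded_integrable _ `|M|) => //; exact: measurable_cst.
apply: (le_trans (le_Rintegral measurableT (integrable_norm fi) cM (fun x _ => fM x))).
by rewrite Rintegral_cst// m1 /= mulr1.
Qed.

Lemma integrable_of_sqr (f : X -> R) : measurable_fun setT f ->
  m.-integrable setT (EFin \o (fun x => f x ^+ 2)) -> m.-integrable setT (EFin \o f).
Proof.
move=> mf f2.
have c1 : m.-integrable setT (EFin \o cst 1).
  by apply: (@bounded_integrable _ 1) => [|x]; [exact: measurable_cst|rewrite normr1].
have := integrableD measurableT c1 f2; apply: le_integrable => //.
  exact/measurable_EFinP.
move=> x _ /=; rewrite lee_fin [leRHS]ger0_norm ?addr_ge0 ?sqr_ge0//.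
rewrite -(real_normK (num_real (f x))); nra.
Qed.

Lemma integrable_mul_sqr (f q : X -> R) :
  measurable_fun setT f -> measurable_fun setT q ->
  m.-integrable setT (EFin \o (fun x => f x ^+ 2)) ->
  m.-integrable setT (EFin \o (fun x => q x ^+ 2)) ->
  m.-integrable setT (EFin \o (fun x => f x * q x)).
Proof.
move=> mf mq f2 q2.
have := integrableD measurableT f2 q2; apply: le_integrable => //.
  by apply/measurable_EFinP; exact: measurable_funM.
move=> x _ /=; rewrite lee_fin [leRHS]ger0_norm ?addr_ge0 ?sqr_ge0//.
rewrite normrM -(real_normK (num_real (f x))) -(real_normK (num_real (q x))).
have := normr_ge0 (f x); have := normr_ge0 (q x); nra.
Qed.

End Finite.

(** * The corrector and the generator *)

Section Semigroup.
Context {R : realType} {d : measure_display} {E : measurableType d}.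
Notation leb := (@lebesgue_measure R).
Variables (P : R -> R.-pker E ~> E) (mu : probability E R).
(* [gb] is the centred observable and [w] dominates its decay; for the theorem
   [w] is a multiple of [sqrt (V + 1)]. *)
Variables (gb w : E -> R) (M ga : R).
Hypothesis PS : transition_semigroup P.
Hypothesis mgb : measurable_fun setT gb.
Hypothesis gbM : forall x, `|gb x| <= M.
Hypothesis gb0 : forall x, Pf P t gb x @[t --> 0^'+] --> gb x.
Hypothesis ga0 : 0 < ga.
Hypothesis mw : measurable_fun setT w.
Hypothesis Gw : forall t x, 0 <= t -> `|Pf P t gb x| <= w x * expR (- (ga * t)).
Hypothesis wmu : mu.-integrable setT (EFin \o (fun x => w x ^+ 2)).
Hypothesis wP : forall t x, 0 <= t ->
  (P t x).-integrable setT (EFin \o (fun x => w x ^+ 2)).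

Let G t x := Pf P t gb x.
Let P1 t x : P t x setT = 1%E. Proof. exact: prob_kernel. Qed.
Let mu1 : mu setT = 1%E. Proof. exact: probability_setT. Qed.

Lemma Pf_measurable t (f : E -> R) : measurable_fun setT f ->
  measurable_fun setT (Pf P t f).
Proof. exact: measurable_Rintegral_kernel. Qed.

Let mG t : measurable_fun setT (G t). Proof. exact: Pf_measurable. Qed.

Lemma Pf_bounded t x : `|Pf P t gb x| <= M.
Proof. exact: normr_Rintegral_le. Qed.

Lemma Pf0 x : Pf P 0 gb x = gb x.
Proof.
rewrite /Pf /Rintegral.
rewrite (@eq_measure_integral _ _ _ _ (\d_x)) => [|A mA _]; last exact: PS.1.
rewrite integral_dirac//; last exact/measurable_EFinP.
by rewrite diracT mul1e.
Qed.

Lemma Pf_add s t x : 0 <= s -> 0 <= t -> Pf P s (Pf P t gb) x = Pf P (s + t) gb x.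
Proof.
move=> s0 t0; apply/esym; rewrite /Pf.
apply: (@Rintegral_kernel _ _ _ _ _ (P t) (giry_of_kernel (P s) x) (P (s + t) x)).
- by move=> A mA; exact: PS.2.
- exact: bounded_integrable.
- by move=> y; exact: bounded_integrable.
Qed.

(** [P (u n) gb = P t (P (u n - t) gb)], where the inner function tends to [gb] pointwise and is
    bounded by [M]; dominated convergence under [P t x] concludes. *)
Lemma Pf_right_continuous x t (u : nat -> R) : 0 <= t -> (forall n, t < u n) ->
  u n @[n --> \oo] --> t -> Pf P (u n) gb x @[n --> \oo] --> Pf P t gb x.
Proof.
move=> t0 ut cu.
have -> : (fun n => Pf P (u n) gb x) = (fun n => Pf P t (G (u n - t)) x).
  apply/funext => n; have ut0 : 0 <= u n - t by rewrite subr_ge0 ltW.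
  by rewrite /G (Pf_add x t0 ut0) addrCA subrr addr0.
apply: (@Rintegral_dominated_cvg _ _ _ (P t x) (fun n => G (u n - t)) gb (cst M)) => //.
- apply: (@bounded_integrable _ _ _ _ _ _ `|M|) => //; exact: measurable_cst.
- by move=> n y; exact: Pf_bounded.
- move=> y; move/cvg_at_rightP : (@gb0 y); apply; split.
    by move=> n; rewrite subr_gt0.
  rewrite -(subrr t); apply: cvgB => //; exact: cvg_cst.
Qed.

Lemma Pf_jointly_measurable :
  measurable_fun (setT `*` `[(0:R), +oo[) (fun p : E * R => Pf P p.2 gb p.1).
Proof.
apply: (@measurable_right_continuous _ _ _ (fun x t => Pf P t gb x)).
- by move=> t _; exact: mG.
- exact: Pf_right_continuous.
Qed.

Let D0 : set (measurableTypeR R) := `[0, +oo[.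
Let mD0 : measurable D0. Proof. exact: measurable_itv. Qed.
Let mGE : measurable_fun (setT `*` D0) (fun p : E * measurableTypeR R => G p.2 p.1).
Proof. exact: Pf_jointly_measurable. Qed.

Let iexp : leb.-integrable D0 (EFin \o (fun t => expR (- (ga * t)))).
Proof.
(* On [[0, +oo[] the function is [ga^-1] times the density of the exponential law. *)
have := integrableZl measurableT ga^-1 (integrable_exponential_pdf ga0).
move/(integrableS measurableT mD0 (@subsetT _ _)).
apply: eq_integrable => // t tD; move: tD; rewrite inE /D0/= in_itv/= andbT => t0.
by rewrite exponential_pdfE// -EFinM mulrA mulVf ?gt_eqF// mul1r mulNr.
Qed.

Definition corrector (x : E) : R := \int[leb]_(t in `[0, +oo[) Pf P t gb x.
Let chi := corrector.
Let C := \int[leb]_(t in D0) expR (- (ga * t)).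

Let wi : mu.-integrable setT (EFin \o w). Proof. exact: integrable_of_sqr. Qed.
Let Gle x t : D0 t -> `|G t x| <= w x * expR (- (ga * t)).
Proof. by rewrite /D0 /= in_itv/= andbT => t0; exact: Gw. Qed.

(** A by-product of Fubini against [mu]: the time integral is a [mu]-integrable function of [x], in
    particular a measurable one. *)
Lemma corrector_measurable : measurable_fun setT chi.
Proof.
apply/measurable_EFinP; apply: (@measurable_int _ _ _ mu).
exact: (@integrable_Rintegral1 _ _ _ mu D0 (fun x t => G t x) w _ mD0 mGE Gle wi iexp).
Qed.

Lemma Pf_integrable_time x : leb.-integrable D0 (EFin \o (fun t => Pf P t gb x)).
Proof.
exact: (@integrable_section _ _ _ D0 (fun x t => G t x) w _ mD0 mGE Gle iexp).
Qed.

Lemma corrector_le x : `|chi x| <= w x * C.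
Proof.
have Gi := Pf_integrable_time x.
apply: (le_trans (le_normr_Rintegral mD0 Gi)).
rewrite /C -RintegralZl//; apply: le_Rintegral => //.
- exact: integrable_norm Gi.
- exact: (integrableZl mD0 (w x) iexp).
- by move=> t; exact: Gle.
Qed.

Lemma Pf_corrector s x : 0 <= s ->
  Pf P s chi x = chi x - \int[leb]_(u in `[0, s]) Pf P u gb x.
Proof.
move=> s0; have Gi := Pf_integrable_time x.
have wi' : (P s x).-integrable setT (EFin \o w).
  by apply: integrable_of_sqr => //; exact: wP.
rewrite /Pf -/(G _ _).
(* The exchange is dominated by [w y * exp (- ga t)], with [w] integrable under [P s x] because its
   square is. *)
have -> : \int[P s x]_y chi y = \int[leb]_(t in D0) \int[P s x]_y G t y.
  exact: (@Rintegral_swap _ _ _ (giry_of_kernel (P s) x) D0 (fun x t => G t x) w _ mD0 mGE Gle wi' iexp).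
transitivity (\int[leb]_(t in D0) G (s + t) x).
  apply: eq_Rintegral => t; rewrite inE /D0 /= in_itv/= andbT => t0.
  exact: Pf_add.
(* Translating time by [s] turns the integral into the tail of the one that defines [chi x]. *)
have -> : D0 = +%R s @^-1` `[s, +oo[.
  by apply/seteqP; split=> t /=; rewrite /D0/= !in_itv/= !andbT lerDl.
have Gis : leb.-integrable `[s, +oo[ (EFin \o (fun t => G t x)).
  by apply: integrableS Gi => //; exact: subset_itvr.
rewrite (@Rintegral_shift _ s `[s, +oo[ (fun t => G t x))//.
rewrite /chi /corrector.
rewrite (Rintegral_itvB Gi)//.
by rewrite Rintegral_itv_obnd_cbnd//; apply: integrableS Gi => //; apply: subset_itvr; rewrite bnd_simp.
Qed.

End Semigroup.

Section L2norm.
Context {R : realType} {d : measure_display} {E : measurableType d}.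
Variable mu : probability E R.
Let mu1 : mu setT = 1%E. Proof. exact: probability_setT. Qed.

Lemma l2norm_le (f : E -> R) (c : R) : measurable_fun setT f ->
  (forall x, `|f x| <= c) -> l2norm mu f <= c.
Proof.
move=> mf fc.
have mf2 : measurable_fun setT (fun x => f x ^+ 2) by exact: measurable_funX.
have f2c x : `|f x ^+ 2| <= c ^+ 2.
  by rewrite normrX lerXn2r ?nnegrE ?(le_trans _ (fc x)).
have c0 : 0 <= c by apply: le_trans (fc point).
rewrite /l2norm -[leRHS](ger0_norm c0) -sqrtr_sqr ler_wsqrtr//.
apply: (le_trans (ler_norm _)); exact: (normr_Rintegral_le mu1 mf2 f2c).
Qed.

(** Bounded convergence. It is stated for sequences; limits as [t -> 0+] are reduced to it by
    [cvg_at_rightP]. *)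
Lemma l2norm_cvg0 (f : nat -> E -> R) (c : R) :
  (forall n, measurable_fun setT (f n)) -> (forall n x, `|f n x| <= c) ->
  (forall x, f n x @[n --> \oo] --> 0) -> l2norm mu (f n) @[n --> \oo] --> 0.
Proof.
move=> mf fc f0.
have : \int[mu]_x (f n x ^+ 2) @[n --> \oo] --> \int[mu]_x (0 ^+ 2).
  apply: (@Rintegral_dominated_cvg _ _ _ mu (fun n x => f n x ^+ 2) (cst (0 ^+ 2)) (cst (c ^+ 2))).
  - by move=> n; exact: measurable_funX.
  - by apply: (@bounded_integrable _ _ _ mu mu1 _ `|c ^+ 2|) => //; exact: measurable_cst.
  - by move=> n x; rewrite normrX lerXn2r ?nnegrE ?(le_trans _ (fc n x)).
  - move=> x; exact: (cvgM (f0 x) (f0 x)).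
rewrite Rintegral_cst// expr0n mul0r => cv.
rewrite -(sqrtr0 R); apply: continuous_cvg cv; exact: sqrt_continuous.
Qed.
End L2norm.

(** * The generator at the corrector *)

Section Generator.
Context {R : realType} {d : measure_display} {E : measurableType d}.
Notation leb := (@lebesgue_measure R).
Variables (P : R -> R.-pker E ~> E) (mu : probability E R).
Variables (gb chi : E -> R) (M : R).
Hypothesis mgb : measurable_fun setT gb.
Hypothesis gbM : forall x, `|gb x| <= M.
Hypothesis gb0 : forall x, Pf P t gb x @[t --> 0^'+] --> gb x.
Hypothesis gb00 : forall x, Pf P 0 gb x = gb x.
Hypothesis mG : measurable_fun (setT `*` `[(0:R), +oo[) (fun p : E * R => Pf P p.2 gb p.1).
Hypothesis mchi : measurable_fun setT chi.
Hypothesis chi_mu : mu.-integrable setT (EFin \o (fun x => chi x ^+ 2)).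
Hypothesis chi_P : forall t x, 0 <= t ->
  (P t x).-integrable setT (EFin \o (fun x => chi x ^+ 2)).
Hypothesis Pf_chi : forall s x, 0 <= s ->
  Pf P s chi x = chi x - \int[leb]_(u in `[0, s]) Pf P u gb x.

Let P1 t x : P t x setT = 1%E. Proof. exact: prob_kernel. Qed.
Let mu1 : mu setT = 1%E. Proof. exact: probability_setT. Qed.
Let GM t x : `|Pf P t gb x| <= M. Proof. exact: Pf_bounded. Qed.

Lemma integrable_cst_itv (s c : R) : leb.-integrable `[0, s] (EFin \o cst c).
Proof.
apply: measurable_bounded_integrable => //.
- by rewrite /= lebesgue_measure_itv/=; case: ifP => // _; rewrite -EFinB ltry.
- exists `|c|; split; first exact: num_real.
  by move=> r cr x _; exact: ltW.
Qed.

Lemma Pf_integrable_itv x s : leb.-integrable `[0, s] (EFin \o (fun t => Pf P t gb x)).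
Proof.
apply: (@integrable_section _ _ _ `[0, s] (fun x t => Pf P t gb x) (cst M) (cst 1)) => //.
- apply: measurable_funS mG => //; first by apply: measurableX => //; exact: measurable_itv.
  by move=> [y t] /= [_]; rewrite !in_itv/= andbT => /andP[].
- by move=> y t _; rewrite mulr1; exact: GM.
- exact: integrable_cst_itv.
Qed.

(** Used with two centres: [c = 0], [e = M] bounds [P t chi - chi] by [M * t], while [c = gb x] with
    small [e] gives the derivative at 0. *)
Lemma avg_bound x s e c : 0 <= s ->
  (forall u, 0 <= u <= s -> `|Pf P u gb x - c| <= e) ->
  `|\int[leb]_(u in `[0, s]) Pf P u gb x - c * s| <= e * s.
Proof.
move=> s0 ce.
have Gi := Pf_integrable_itv x s; have ci := integrable_cst_itv s c.
have fs : fine (leb `[0, s]%classic) = s.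
  by rewrite lebesgue_measure_itv/= lte_fin; case: ltP => //= [_|s0']; [rewrite subr0|apply/eqP; rewrite eq_le s0 s0'].
have -> : \int[leb]_(u in `[0, s]) Pf P u gb x - c * s =
  \int[leb]_(u in `[0, s]) (Pf P u gb x - cst c u).
  by rewrite RintegralB// Rintegral_cst// fs.
have Gci : leb.-integrable `[0, s] (EFin \o (fun u => Pf P u gb x - cst c u)).
  exact: (integrableB _ Gi ci).
apply: (le_trans (le_normr_Rintegral _ Gci)) => //.
rewrite -[X in _ <= e * X]fs -Rintegral_cst//.
apply: le_Rintegral => //.
- exact: integrable_norm Gci.
- exact: integrable_cst_itv.
Qed.

Let mPchi t : measurable_fun setT (Pf P t chi). Proof. exact: Pf_measurable. Qed.

Lemma Pf_chi_diff_le t x : 0 <= t -> `|Pf P t chi x - chi x| <= M * t.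
Proof.
move=> t0; rewrite Pf_chi// addrAC subrr add0r normrN.
have := @avg_bound x t M 0 t0; rewrite mul0r subr0; apply.
by move=> u _; rewrite subr0; exact: GM.
Qed.

Lemma avg_cvg x : (Pf P t chi x - chi x) / t + gb x @[t --> 0^'+] --> 0.
Proof.
apply/cvgr0Pnorm_le => e e0.
have /cvgrPdist_le /(_ e e0) := @gb0 x.
move=> [D /= D0 H]; exists D => //= t tD t0.
have -> : (Pf P t chi x - chi x) / t + gb x =
  - (\int[leb]_(u in `[0, t]) Pf P u gb x - gb x * t) / t.
  by rewrite Pf_chi ?ltW//; field; rewrite gt_eqF.
rewrite normrM normrN normfV (gtr0_norm t0) ler_pdivrMr//.
apply: avg_bound => [|u /andP[]]; first exact: ltW.
(* A right limit says nothing about the endpoint [u = 0], where [gb00] gives the exact value. *)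
rewrite le_eqVlt => /predU1P[<- _|u0 ut]; first by rewrite gb00 subrr normr0 ltW.
rewrite distrC; apply: H => //=.
rewrite sub0r normrN gtr0_norm//; apply: (le_lt_trans ut).
by move: tD; rewrite /= sub0r normrN gtr0_norm.
Qed.

Let gen_approx t x := (Pf P t chi x - chi x) / t.

Lemma gen_approx_measurable t : measurable_fun setT (gen_approx t).
Proof. by apply: measurable_funM => //; exact: measurable_funB. Qed.

Lemma gen_approx_le t x : 0 < t -> `|gen_approx t x| <= M.
Proof.
move=> t0; rewrite normrM normfV (gtr0_norm t0) ler_pdivrMr//.
exact/Pf_chi_diff_le/ltW.
Qed.

Let M0 : 0 <= M. Proof. exact: le_trans (gbM point). Qed.

(** Although [chi] may be unbounded, its difference quotients are bounded by [M] uniformly in [t]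
    and [x], so pointwise convergence suffices. *)
Lemma gen_approx_cvg :
  l2norm mu (fun x => gen_approx t x - (- gb x)) @[t --> 0^'+] --> 0.
Proof.
apply/cvg_at_rightP => u [u0 cu].
apply: (@l2norm_cvg0 _ _ _ _ _ (M + M)).
- by move=> n; apply: measurable_funB; [exact: gen_approx_measurable|exact: measurableT_comp].
- move=> n x; rewrite opprK; apply: (le_trans (ler_normD _ _)).
  by rewrite lerD// gen_approx_le.
- by move=> x; move/cvg_at_rightP : (@avg_cvg x); under eq_fun do rewrite opprK; apply.
Qed.

Lemma LL_chi : LL mu P chi.
Proof.
split => //; first exact: integrable_lty chi_mu.
by move=> x t t0; exact: integrable_lty (chi_P x t0).
Qed.


Lemma LL0_chi : LL0 mu P chi.
Proof.
split; first exact: LL_chi.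
apply/cvg_at_rightP => u [u0 cu].
apply: (@squeeze_cvgr _ _ _ _ (cst 0) (fun n => M * u n)).
- apply: nearW => n; rewrite sqrtr_ge0 /=; apply: l2norm_le.
    exact: measurable_funB.
  by move=> x; apply: Pf_chi_diff_le; exact: ltW.
- exact: cvg_cst.
- rewrite -[X in _ --> X](mulr0 M); apply: cvgM => //; exact: cvg_cst.
Qed.

Let mNgb : measurable_fun setT (fun x => - gb x). Proof. exact: measurableT_comp. Qed.

Let sqr_bounded (m : {measure set E -> \bar R}) : m setT = 1%E ->
  m.-integrable setT (EFin \o (fun x => (- gb x) ^+ 2)).
Proof.
move=> m1; apply: (@bounded_integrable _ _ _ m m1 _ (M ^+ 2)).
  exact: measurable_funX.
by move=> x; rewrite normrX lerXn2r ?nnegrE// normrN.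
Qed.

Lemma PfN t (f : E -> R) x : measurable_fun setT f -> (forall y, `|f y| <= M) ->
  Pf P t (fun y => - f y) x = - Pf P t f x.
Proof.
move=> mf fM; have fi := bounded_integrable (P1 t x) mf fM.
rewrite /Pf -[RHS]mulN1r -RintegralZl//.
by apply: eq_Rintegral => y _; rewrite mulN1r.
Qed.

Lemma LL0_gb : LL0 mu P (fun x => - gb x).
Proof.
split.
  split => //; first exact/integrable_lty/sqr_bounded.
  by move=> x t t0; exact/integrable_lty/sqr_bounded.
apply/cvg_at_rightP => u [u0 cu].
apply: (@l2norm_cvg0 _ _ _ _ _ (M + M)).
- by move=> n; apply: measurable_funB => //; exact: Pf_measurable.
- move=> n x; rewrite PfN// -opprD normrN; apply: (le_trans (ler_normB _ _)).
  by rewrite lerD.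
- move=> x; rewrite (_ : (fun n => _) = (fun n => gb x - Pf P (u n) gb x)); last first.
    by apply/funext => n; rewrite PfN// opprK addrC.
  rewrite -(subrr (gb x)); apply: cvgB; first exact: cvg_cst.
  by move/cvg_at_rightP : (@gb0 x); apply.
Qed.

Lemma gen_value_chi : gen_value mu P chi (fun x => - gb x).
Proof. by split; [exact: LL0_chi|exact: LL0_gb|exact: gen_approx_cvg]. Qed.

Lemma l2norm_sqr (f : E -> R) : l2norm mu f ^+ 2 = \int[mu]_x (f x ^+ 2).
Proof. by rewrite sqr_sqrtr//; apply: Rintegral_ge0 => x _; exact: sqr_ge0. Qed.

(* [l2norm] is [0] on functions that are not square integrable, so the square
   integrability of every function involved has to be checked. *)
Lemma gen_value_unique (h : E -> R) : gen_value mu P chi h ->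
  ae_eq mu setT (EFin \o h) (EFin \o (fun x => - gb x)).
Proof.
move=> [_ [[mh h2 _] _] cvh].
have h2i : mu.-integrable setT (EFin \o (fun x => h x ^+ 2)).
  apply/integrableP; split; first by apply/measurable_EFinP; exact: measurable_funX.
  by under eq_integral do rewrite /= ger0_norm ?sqr_ge0//.
have sqrB_i (f q : E -> R) : measurable_fun setT f -> measurable_fun setT q ->
    mu.-integrable setT (EFin \o (fun x => f x ^+ 2)) ->
    mu.-integrable setT (EFin \o (fun x => q x ^+ 2)) ->
    mu.-integrable setT (EFin \o (fun x => (f x - q x) ^+ 2)).
  move=> mf mq fi qi.
  have := integrableZl measurableT 2 (integrableD measurableT fi qi).
  apply: le_integrable => //.
    by apply/measurable_EFinP/measurable_funX; exact: measurable_funB.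
  move=> x _ /=; rewrite lee_fin !ger0_norm ?sqr_ge0 ?mulr_ge0 ?addr_ge0 ?sqr_ge0//.
  by have := sqr_ge0 (f x + q x); rewrite sqrrD sqrrB; lra.
have gi : mu.-integrable setT (EFin \o (fun x => (- gb x) ^+ 2)) by exact: sqr_bounded.
pose k x := h x - (- gb x).
have ki : mu.-integrable setT (EFin \o (fun x => k x ^+ 2)) by exact: sqrB_i.
(* With [a] the difference quotient, [(b - c)^2 <= 2 ((a - b)^2 + (a - c)^2)] for [b = h x] and
   [c = - gb x]; both terms on the right have integrals tending to 0 with [t]. *)
have k0 : \int[mu]_x (k x ^+ 2) <= 0.
  have cv : 2 * (l2norm mu (fun x => gen_approx t x - h x) ^+ 2 +
      l2norm mu (fun x => gen_approx t x - (- gb x)) ^+ 2) @[t --> 0^'+] --> (2 * (0 ^+ 2 + 0 ^+ 2) : R).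
    apply: cvgM; first exact: cvg_cst.
    by apply: cvgD; apply: cvgM => //; exact: gen_approx_cvg.
  rewrite expr0n addr0 mulr0 in cv.
  apply: (cvgr_to_ge cv); near=> t.
  have t0 : 0 < t by near: t; exact: nbhs_right_gt.
  have ai : mu.-integrable setT (EFin \o (fun x => gen_approx t x ^+ 2)).
    apply: (@bounded_integrable _ _ _ mu mu1 _ (M ^+ 2)).
      by apply: measurable_funX; exact: gen_approx_measurable.
    by move=> x; rewrite normrX lerXn2r ?nnegrE// gen_approx_le.
  have mga := gen_approx_measurable t.
  have i1 := sqrB_i _ _ mga mh ai h2i.
  have i2 := sqrB_i _ _ mga mNgb ai gi.
  have i12 : mu.-integrable setT (EFin \o (fun x =>
      (gen_approx t x - h x) ^+ 2 + (gen_approx t x - (- gb x)) ^+ 2)).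
    exact: (integrableD measurableT i1 i2).
  rewrite !l2norm_sqr -RintegralD// -RintegralZl//.
  apply: le_Rintegral => //; first exact: (integrableZl measurableT 2 i12).
  move=> x _; rewrite /k.
  set a := gen_approx t x; set b := h x; set c := - gb x.
  by have := sqr_ge0 ((a - b) + (a - c)); nra.
have k0' : (\int[mu]_x `|(k x ^+ 2)%:E| = 0)%E.
  under eq_integral do rewrite /= ger0_norm ?sqr_ge0//.
  rewrite -[LHS]fineK ?integrable_fin_num//; congr EFin.
  by apply/eqP; rewrite eq_le k0 Rintegral_ge0// => x _; exact: sqr_ge0.
have mk2 : measurable_fun setT (EFin \o (fun x => k x ^+ 2)) by exact: measurable_int ki.
have := (ae_eq_integral_abs mu measurableT mk2).1 k0'.
apply: filterS => x /= /(_ I) [] /eqP; rewrite sqrf_eq0 => /eqP kx _.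
by congr EFin; apply/eqP; rewrite -subr_eq0 -/(k x) kx.
Unshelve. all: by end_near. Qed.

Lemma integral_gen_value (h : E -> R) : gen_value mu P chi h ->
  (\int[mu]_x (chi x * h x)%:E = - (\int[mu]_x (chi x * gb x))%:E)%E.
Proof.
move=> gh; have [_ [[mh _ _] _] _] := gh.
have cgi : mu.-integrable setT (EFin \o (fun x => chi x * gb x)).
  apply: integrable_mul_sqr => //; have := sqr_bounded mu1.
  by apply: eq_integrable => // x _; rewrite /= sqrrN.
transitivity (\int[mu]_x (- (chi x * gb x)%:E))%E.
  apply: ae_eq_integral => //.
  - by apply/measurable_EFinP; exact: measurable_funM.
  - by apply: measurableT_comp => //; exact: measurable_int cgi.
  - have := gen_value_unique gh; apply: filterS => x /= /[apply] [[->]].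
    by rewrite mulrN.
rewrite integralN; last exact: integrable_add_def.
by rewrite /Rintegral fineK//; exact: integrable_fin_num.
Qed.

End Generator.

(** * The variance of the martingale *)

Section Variance.
Context {R : realType} {d dO : measure_display}.
Context {E : measurableType d} {Om : measurableType dO}.
Notation leb := (@lebesgue_measure R).
Variables (Pr : probability Om R) (Psi : R -> Om -> E).
Variables (P : R -> R.-pker E ~> E) (mu : probability E R).
Variables (gb chi : E -> R) (M : R).
Hypothesis markov : markov_process Pr Psi P.
Hypothesis init : forall A, measurable A -> Pr (Psi 0 @^-1` A) = mu A.
Hypothesis inv : forall t, 0 <= t -> is_mix mu (P t) mu.
Hypothesis mgb : measurable_fun setT gb.
Hypothesis gbM : forall x, `|gb x| <= M.
Hypothesis mG : measurable_fun (setT `*` `[(0:R), +oo[) (fun p : E * R => Pf P p.2 gb p.1).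
Hypothesis mchi : measurable_fun setT chi.
Hypothesis chi_mu : mu.-integrable setT (EFin \o (fun x => chi x ^+ 2)).
Hypothesis chi_P : forall t x, 0 <= t ->
  (P t x).-integrable setT (EFin \o (fun x => chi x ^+ 2)).
Hypothesis Pf_chi : forall s x, 0 <= s ->
  Pf P s chi x = chi x - \int[leb]_(u in `[0, s]) Pf P u gb x.

Let P1 t x : P t x setT = 1%E. Proof. exact: prob_kernel. Qed.
Let mu1 : mu setT = 1%E. Proof. exact: probability_setT. Qed.
Let Pr1 : Pr setT = 1%E. Proof. exact: probability_setT. Qed.
Let GM t x : `|Pf P t gb x| <= M. Proof. exact: Pf_bounded. Qed.

Let mPsi t : 0 <= t -> measurable_fun setT (Psi t).
Proof. by case: markov => _ + _ _; apply. Qed.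

Lemma markov_two_point_initial s h A B : 0 <= s -> 0 <= h -> measurable A -> measurable B ->
  Pr (Psi s @^-1` A `&` Psi (s + h) @^-1` B) =
  (\int[Pr]_w ((\1_A (Psi s w))%:E * P h (Psi s w) B))%E.
Proof.
move=> s0 h0 mA mB; have [_ _ _ fdd] := markov.
have := fdd s A [:: (h, B)] s0 mA; rewrite /= h0 => /(_ isT).
have mB' : forall p, p \in [:: (h, B)] -> measurable p.2.
  by move=> p; rewrite inE => /eqP ->.
move=> /(_ mB') H.
have -> : Psi s @^-1` A `&` Psi (s + h) @^-1` B =
    [set w | A (Psi s w) /\ B (Psi (s + h) w) /\ True].
  by apply/seteqP; split=> w /= ?; tauto.
rewrite H; apply: eq_integral => w _; congr (_ * _)%E.
by rewrite integral_cst// mul1e.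
Qed.

(** The law at time [s] is a premise because the lemma serves twice: at time 0, where it is [init],
    to derive stationarity, and afterwards at any time. *)
Lemma ge0_integral_law s (f : E -> \bar R) : 0 <= s ->
  (forall A, measurable A -> Pr (Psi s @^-1` A) = mu A) ->
  measurable_fun setT f -> (forall x, 0 <= f x)%E ->
  (\int[Pr]_w f (Psi s w) = \int[mu]_x f x)%E.
Proof.
move=> s0 ls mf f0.
have <- : giry_int (giry_map (mPsi s0) Pr) f = (\int[Pr]_w f (Psi s w))%E.
  exact: (giry_int_map (mPsi s0) Pr mf f0).
by apply: eq_measure_integral => A mA _; exact: ls.
Qed.

Let m1P (A B : set E) h : measurable A -> measurable B ->
  measurable_fun setT (fun x => (\1_A x)%:E * P h x B)%E.
Proof.
move=> mA mB; apply: emeasurable_funM; last exact: measurable_kernel.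
exact/measurable_EFinP/measurable_indic.
Qed.

(** The two-point formula started at time 0 with the whole space as first set gives the
    [mu]-integral of [P s x A], which invariance identifies. *)
Lemma stationary_law s A : 0 <= s -> measurable A -> Pr (Psi s @^-1` A) = mu A.
Proof.
move=> s0 mA; have := markov_two_point_initial (lexx 0) s0 measurableT mA.
rewrite preimage_setT setTI add0r => ->.
rewrite (@ge0_integral_law 0 (fun x => (\1_setT x)%:E * P s x A)%E)//.
- by rewrite (inv s0 mA); apply: eq_integral => x _; rewrite indicT mul1e.
- exact: m1P.
Qed.

Lemma stationary_pair s h A B : 0 <= s -> 0 <= h -> measurable A -> measurable B ->
  Pr (Psi s @^-1` A `&` Psi (s + h) @^-1` B) = (\int[mu]_(x in A) P h x B)%E.
Proof.
move=> s0 h0 mA mB; rewrite markov_two_point_initial//.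
rewrite (@ge0_integral_law s (fun x => (\1_A x)%:E * P h x B)%E)//.
- rewrite (integral_mkcond A); apply: eq_integral => x _; rewrite patchE indicE.
  by case: ifP => xA; rewrite ?mul1e ?mul0e.
- by move=> C mC; exact: stationary_law.
- exact: m1P.
Qed.

Let sqi (f : E -> R) := mu.-integrable setT (EFin \o (fun x => f x ^+ 2)).

Let sq_Psi s f : 0 <= s -> sqi f ->
  Pr.-integrable setT (EFin \o (fun w => f (Psi s w) ^+ 2)).
Proof.
move=> s0 fi.
exact: (@integrable_law _ _ _ _ _ Pr mu (Psi s) (mPsi s0) (fun A mA => stationary_law s0 mA) _ fi).
Qed.

(** Stands in for conditioning on [Psi s]: the later factor [q (Psi (s + h))] is replaced by [P h q]
    at the earlier point. *)
Lemma stationary_correlation s h (f q : E -> R) : 0 <= s -> 0 <= h ->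
  measurable_fun setT f -> measurable_fun setT q -> sqi f -> sqi q ->
  (forall x, (P h x).-integrable setT (EFin \o q)) ->
  \int[Pr]_w (f (Psi s w) * q (Psi (s + h) w)) = \int[mu]_x (f x * Pf P h q x).
Proof.
move=> s0 h0 mf mq fi qi qP; have sh0 := addr_ge0 s0 h0.
apply: (@Rintegral_pair _ _ _ _ _ (P h) _ _ Pr mu) => //.
- exact: mPsi.
- exact: mPsi.
- by move=> A B mA mB; exact: stationary_pair.
- apply: (@integrable_mul_sqr _ _ _ Pr (f \o Psi s) (q \o Psi (s + h))).
  + by apply: measurableT_comp => //; exact: mPsi.
  + by apply: measurableT_comp => //; exact: mPsi.
  + exact: sq_Psi.
  + exact: sq_Psi.
Qed.

Let M0 : 0 <= M. Proof. exact: le_trans (gbM point). Qed.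

Let gb_sq : sqi gb.
Proof.
apply: (@bounded_integrable _ _ _ mu mu1 _ (M ^+ 2)); first exact: measurable_funX.
by move=> x; rewrite normrX lerXn2r ?nnegrE.
Qed.

Let gbP h x : (P h x).-integrable setT (EFin \o gb).
Proof. exact: bounded_integrable. Qed.

Let chiP h x : 0 <= h -> (P h x).-integrable setT (EFin \o chi).
Proof. by move=> h0; apply: integrable_of_sqr => //; exact: chi_P. Qed.

(** For [u >= 0] and square integrable [f], the stationary correlation of [f (Psi s)] with
    [gb (Psi (s + u))]; not the metric of the theorem. *)
Let rho f u := \int[mu]_x (f x * Pf P u gb x).

Section Correlation.
Variable f : E -> R.
Hypotheses (mf : measurable_fun setT f) (fi : sqi f).

Let mfG h : measurable_fun (setT `*` (`[0, h]%classic : set (measurableTypeR R)))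
  (fun p : E * measurableTypeR R => f p.1 * Pf P p.2 gb p.1).
Proof.
apply: measurable_funM.
  by apply: measurable_funTS; apply: measurableT_comp.
apply: measurable_funS mG => //; first by apply: measurableX => //; exact: measurable_itv.
by move=> [y t] /= [_]; rewrite !in_itv/= andbT => /andP[].
Qed.

Let fGle h x s : (`[0, h]%classic : set (measurableTypeR R)) s ->
  `|f x * Pf P s gb x| <= `|f x| * cst M s.
Proof. by move=> _; rewrite normrM ler_wpM2l. Qed.

Let fabs : mu.-integrable setT (EFin \o (fun x => `|f x|)).
Proof. by apply: integrable_norm; exact: integrable_of_sqr. Qed.

Lemma correlation_integrable h : leb.-integrable `[0, h] (EFin \o rho f).
Proof.
exact: (@integrable_Rintegral2 _ _ _ mu `[0, h] (fun x u => f x * Pf P u gb x) _ _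
  (measurable_itv _) (@mfG h) (@fGle h) fabs (integrable_cst_itv h M)).
Qed.

Lemma correlation_corrector h : 0 <= h ->
  \int[mu]_x (f x * Pf P h chi x) =
  \int[mu]_x (f x * chi x) - \int[leb]_(u in `[0, h]) rho f u.
Proof.
move=> h0.
have -> : \int[leb]_(u in `[0, h]) rho f u =
    \int[mu]_x (\int[leb]_(u in `[0, h]) (f x * Pf P u gb x)).
  by rewrite (@Rintegral_swap _ _ _ mu `[0, h] (fun x u => f x * Pf P u gb x) _ _
    (measurable_itv _) (@mfG h) (@fGle h) fabs (integrable_cst_itv h M)).
rewrite -RintegralB//.
- apply: eq_Rintegral => x _; rewrite Pf_chi// mulrBr RintegralZl//.
  exact: Pf_integrable_itv.
- exact: integrable_mul_sqr.
- exact: (@integrable_Rintegral1 _ _ _ mu `[0, h] (fun x u => f x * Pf P u gb x) _ _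
    (measurable_itv _) (@mfG h) (@fGle h) fabs (integrable_cst_itv h M)).
Qed.
End Correlation.

Let I01 : set (measurableTypeR R) := `[0, 1].
Let mI01 : measurable I01. Proof. exact: measurable_itv. Qed.

Let leb1 : fine (leb I01) = 1.
Proof. by rewrite lebesgue_measure_itv/= lte_fin ltr01 -EFinB subr0. Qed.

Let mb : measurable_fun (setT `*` I01)
  (fun p : Om * measurableTypeR R => gb (Psi p.2 p.1)).
Proof.
have [_ _ mPsi2 _] := markov.
apply: measurableT_comp => //; apply: measurable_funS mPsi2 => //.
  by apply: measurableX => //; exact: measurable_itv.
by move=> [y t] /= [_]; rewrite !in_itv/= andbT => /andP[].
Qed.

Let occ w := \int[leb]_(s in `[0, 1]) gb (Psi s w).

(** * Products with the time integral of [gb] along the path *)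

Section Occupation.
Variable Z : Om -> R.
Hypotheses (mZ : measurable_fun setT Z) (iZ : Pr.-integrable setT (EFin \o Z)).

Let mZb : measurable_fun (setT `*` I01)
  (fun p : Om * measurableTypeR R => Z p.1 * gb (Psi p.2 p.1)).
Proof.
by apply: measurable_funM => //; apply: measurable_funTS; exact: measurableT_comp.
Qed.

Let Zble w s : I01 s -> `|Z w * gb (Psi s w)| <= `|Z w| * cst M s.
Proof. by move=> _; rewrite normrM ler_wpM2l. Qed.

Let Zabs : Pr.-integrable setT (EFin \o (fun w => `|Z w|)).
Proof. exact: integrable_norm. Qed.

Let iM := integrable_cst_itv (1 : R) M.

Let ib1 w : leb.-integrable I01 (EFin \o (fun s => gb (Psi s w))).
Proof.
have ble v s : I01 s -> `|gb (Psi s v)| <= cst 1 v * cst M s by rewrite mul1r.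
exact: (@integrable_section _ _ _ I01 (fun w s => gb (Psi s w)) (cst 1) (cst M) mI01 mb ble iM w).
Qed.

Let occZ w : Z w * occ w = \int[leb]_(s in I01) (Z w * gb (Psi s w)).
Proof. by rewrite RintegralZl. Qed.

(** The factor [Z] will be the constant 1, [gb (Psi s)], [chi (Psi s)] and [occ] itself; as [gb] is
    bounded, the product bound is [|Z w| * M]. *)
Lemma integrable_occupation : Pr.-integrable setT (EFin \o (fun w => Z w * occ w)).
Proof.
have := @integrable_Rintegral1 _ _ _ Pr I01 (fun w s => Z w * gb (Psi s w)) _ _ mI01 mZb Zble Zabs iM.
by apply: eq_integrable => // w _; rewrite /= occZ.
Qed.

Lemma integrable_occupation_time :
  leb.-integrable `[0, 1] (EFin \o (fun s => \int[Pr]_w (Z w * gb (Psi s w)))).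
Proof.
exact: (@integrable_Rintegral2 _ _ _ Pr I01 (fun w s => Z w * gb (Psi s w)) _ _ mI01 mZb Zble Zabs iM).
Qed.

Lemma Rintegral_occupation : \int[Pr]_w (Z w * occ w) =
  \int[leb]_(s in `[0, 1]) \int[Pr]_w (Z w * gb (Psi s w)).
Proof.
under eq_Rintegral do rewrite occZ.
exact: (@Rintegral_swap _ _ _ Pr I01 (fun w s => Z w * gb (Psi s w)) _ _ mI01 mZb Zble Zabs iM).
Qed.

End Occupation.

(* [fwd s] and [bwd s] are the integrals of [rho gb (r - s)] over [s <= r <= 1]
   and of [rho gb (s - r)] over [0 <= r <= s]: [r1] is [0] at negative times. *)
Let r1 : R -> R := (rho gb) \_ `[0, 1].

Let mr1 : measurable_fun setT r1.
Proof.
apply/(measurable_restrictT _ _).1 => //; apply/measurable_EFinP.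
exact: measurable_int (correlation_integrable mgb gb_sq 1).
Qed.

Let r1M t : `|r1 t| <= M * M.
Proof.
rewrite /r1 patchE; case: ifP => _; last by rewrite normr0 mulr_ge0.
apply: (normr_Rintegral_le mu1); first by apply: measurable_funM => //; exact: Pf_measurable.
by move=> x; rewrite normrM ler_pM.
Qed.

(** The cut-off in [s] is part of the kernel because the Fubini lemma integrates its first variable
    over the whole space. *)
Let K (s r : R) : R := \1_I01 s * r1 (r - s).

Let mK : measurable_fun (setT `*` I01) (fun p : measurableTypeR R * measurableTypeR R => K p.1 p.2).
Proof.
apply: measurable_funTS; apply: measurable_funM.
  by apply: measurableT_comp => //; exact: measurable_indic.
by apply: measurableT_comp => //; exact: measurable_funB.
Qed.

Let Kle s r : I01 r -> `|K s r| <= \1_I01 s * cst (M * M) r.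
Proof. by move=> _; rewrite normrM ger0_norm// ler_wpM2l. Qed.

Let i1 : leb.-integrable setT (EFin \o (\1_I01 : R -> R)).
Proof. exact: integrable_indic_itv. Qed.

Let iMM := integrable_cst_itv (1 : R) (M * M).

Let fwd s := \int[leb]_(r in `[0, 1]) r1 (r - s).
Let bwd s := \int[leb]_(r in `[0, 1]) r1 (s - r).

(** Both double integrals are that of [K]: integrating out [r] leaves [fwd] on the unit interval,
    integrating out [s] leaves [bwd]. *)
Let fwd_bwd : [/\ leb.-integrable `[0, 1] (EFin \o fwd), leb.-integrable `[0, 1] (EFin \o bwd) &
  \int[leb]_(s in `[0, 1]) fwd s = \int[leb]_(s in `[0, 1]) bwd s].
Proof.
have j1 := @integrable_Rintegral1 _ _ _ leb I01 K _ _ mI01 mK Kle i1 iMM.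
have j2 := @integrable_Rintegral2 _ _ _ leb I01 K _ _ mI01 mK Kle i1 iMM.
have j3 := @Rintegral_swap _ _ _ leb I01 K _ _ mI01 mK Kle i1 iMM.
have E1 s : I01 s -> \int[leb]_(r in I01) K s r = fwd s.
  move=> /mem_set sI; apply: eq_Rintegral => r _.
  by rewrite /K indicE sI mul1r.
have E2 r : \int[leb]_s K s r = bwd r.
  rewrite /bwd [RHS]Rintegral_mkcond; apply: eq_Rintegral => s _.
  by rewrite /K indicE patchE; case: ifP => _; rewrite ?mul1r ?mul0r.
split.
- apply: (eq_integrable mI01 _ _ _ (integrableS measurableT mI01 (@subsetT _ _) j1)).
  move=> s /set_mem sI; congr EFin; exact: E1.
- apply: (eq_integrable mI01 _ _ _ j2) => r _; congr EFin; exact: E2.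
- transitivity (\int[leb]_s (\int[leb]_(r in I01) K s r)).
    rewrite Rintegral_mkcond; apply: eq_Rintegral => s _.
    rewrite patchE; case: ifP => sI; first exact/esym/E1/set_mem.
    rewrite /Rintegral integral0_eq => [|r _]; first by [].
    by rewrite /K indicE sI mul0r.
  by rewrite j3; apply: eq_Rintegral => r _; exact: E2.
Qed.

Let fwdE s : 0 <= s <= 1 ->
  fwd s = \int[leb]_(u in `[0, 1 - s]) rho gb u.
Proof.
move=> /andP[s0 s1].
have rs : leb.-integrable `[0, 1 - s] (EFin \o rho gb) by exact: correlation_integrable.
rewrite -(@Rintegral_shift _ (- s) `[0, 1 - s] (rho gb))//.
have EI (f : R -> R) (a b x : R) : (f \_ `[a, b]) x = if a <= x <= b then f x else 0.
  by rewrite patchE; congr (if _ then _ else _); apply/idP/idP; rewrite inE/= in_itv.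
have EJ (f : R -> R) (r : R) :
    (f \_ (+%R (- s) @^-1` `[0, 1 - s])) r = if 0 <= r - s <= 1 - s then f r else 0.
  have -> : +%R (- s) @^-1` `[0, 1 - s] = `[s, 1]%classic.
    by apply/seteqP; split=> t /=; rewrite !in_itv/=; lra.
  by rewrite EI subr_ge0 lerD2r.
rewrite /fwd Rintegral_mkcond [RHS]Rintegral_mkcond; apply: eq_Rintegral => r _.
transitivity (if 0 <= r <= 1 then r1 (r - s) else 0); first exact: (EI (fun r => r1 (r - s))).
transitivity (if 0 <= r - s <= 1 - s then rho gb (- s + r) else 0); last by rewrite -(EJ (fun r => rho gb (- s + r))).
rewrite /r1 (EI (rho gb)) (addrC (- s)).
(* For [0 <= s <= 1] the bound [r <= 1] is the sharper upper bound and [s <= r] the sharper lower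
   one. *)
have <- : (0 <= r <= 1) && (0 <= r - s <= 1) = (0 <= r - s <= 1 - s).
  apply/idP/idP => [/andP[/andP[? ?] /andP[? ?]]|/andP[? ?]].
    by apply/andP; split; lra.
  by apply/andP; split; apply/andP; split; lra.
by case: (0 <= r <= 1).
Qed.

Lemma Rintegral_eq_except (D : set (measurableTypeR R)) (s : R) (f q : R -> R) : measurable D ->
  leb.-integrable D (EFin \o f) -> leb.-integrable D (EFin \o q) ->
  (forall r, D r -> r != s -> f r = q r) ->
  \int[leb]_(r in D) f r = \int[leb]_(r in D) q r.
Proof.
move=> mD fi qi fq; rewrite /Rintegral; congr fine; apply: ae_eq_integral => //.
- exact: measurable_int fi.
- exact: measurable_int qi.
- exists [set s]; split; first exact: measurable_set1.
    exact: lebesgue_measure_set1.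
  move=> r /= /not_implyP[Dr]; apply: contra_notP => /eqP rs.
  by rewrite fq.
Qed.

Let X w := chi (Psi 1 w).
Let Y w := chi (Psi 0 w).

Let mgbPsi s : 0 <= s -> measurable_fun setT (fun w => gb (Psi s w)).
Proof. by move=> s0; apply: measurableT_comp => //; exact: mPsi. Qed.
Let igbPsi s : 0 <= s -> Pr.-integrable setT (EFin \o (fun w => gb (Psi s w))).
Proof. by move=> s0; apply: (bounded_integrable Pr1 (mgbPsi s0)) => w; exact: gbM. Qed.
Let mchiPsi s : 0 <= s -> measurable_fun setT (fun w => chi (Psi s w)).
Proof. by move=> s0; apply: measurableT_comp => //; exact: mPsi. Qed.
Let chiPsi2 s : 0 <= s -> Pr.-integrable setT (EFin \o (fun w => chi (Psi s w) ^+ 2)).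
Proof. by move=> s0; exact: sq_Psi. Qed.
Let ichiPsi s : 0 <= s -> Pr.-integrable setT (EFin \o (fun w => chi (Psi s w))).
Proof. by move=> s0; apply: (integrable_of_sqr Pr1 (mchiPsi s0)); exact: chiPsi2. Qed.

Let iocc : Pr.-integrable setT (EFin \o occ).
Proof.
have m1' : measurable_fun setT (cst 1 : Om -> R) by exact: measurable_cst.
have i1' : Pr.-integrable setT (EFin \o (cst 1 : Om -> R)).
  by apply: (bounded_integrable Pr1 m1') => w; rewrite normr1.
have := integrable_occupation m1' i1'.
by apply: eq_integrable => // w _; rewrite /= mul1r.
Qed.
Let mocc : measurable_fun setT occ.
Proof. by apply/measurable_EFinP; exact: measurable_int iocc. Qed.

Let corr_gg s r : 0 <= s -> s <= r -> r <= 1 ->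
  \int[Pr]_w (gb (Psi s w) * gb (Psi r w)) = r1 (r - s).
Proof.
move=> s0 sr r1'.
have rs0 : 0 <= r - s by rewrite subr_ge0.
have := stationary_correlation s0 rs0 mgb mgb gb_sq gb_sq (gbP _).
rewrite (_ : s + (r - s) = r) => [->|]; last by rewrite addrC subrK.
by rewrite /r1 patchE mem_set//= in_itv/= subr_ge0 sr lerBlDr (le_trans r1')// lerDl.
Qed.

Let occ_gb s : 0 <= s <= 1 -> \int[Pr]_w (occ w * gb (Psi s w)) = fwd s + bwd s.
Proof.
move=> /andP[s0 s1].
have r1_integrable (h : measurableTypeR R -> measurableTypeR R) : measurable_fun setT h ->
    leb.-integrable I01 (EFin \o (r1 \o h)).
  move=> mh; have := iMM; apply: (le_integrable mI01).
    apply/measurable_EFinP; exact: (measurable_funTS (measurableT_comp mr1 mh)).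
  move=> r _ /=; rewrite lee_fin [leRHS]ger0_norm ?mulr_ge0//; exact: r1M.
have if1 : leb.-integrable I01 (EFin \o (fun r => r1 (r - s))) :=
  r1_integrable _ (measurable_funB (@measurable_id _ _ setT) (measurable_cst s)).
have if2 : leb.-integrable I01 (EFin \o (fun r => r1 (s - r))) :=
  r1_integrable _ (measurable_funB (measurable_cst s) (@measurable_id _ _ setT)).
under eq_Rintegral do rewrite mulrC.
rewrite (Rintegral_occupation (mgbPsi s0) (igbPsi s0)) -(RintegralD mI01 if1 if2).
(* At [r = s] both halves contribute [r1 0], twice the true correlation; this single point is
   negligible. *)
apply: (@Rintegral_eq_except _ s) => //.
- exact: integrable_occupation_time (mgbPsi s0) (igbPsi s0).
- exact: (integrableD mI01 if1 if2).
- move=> r /=; rewrite in_itv/= => /andP[r0 r1'] rs.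
  have r1_neg t : t < 0 -> r1 t = 0.
    by move=> t0; rewrite /r1 patchE memNset//= in_itv/= leNgt t0.
  have [sr|sr|sr] := ltgtP s r.
  + by rewrite (corr_gg s0 (ltW sr) r1') (r1_neg (s - r)) ?subr_lt0// addr0.
  + under eq_Rintegral do rewrite mulrC.
    by rewrite (corr_gg r0 (ltW sr) s1) (r1_neg (r - s)) ?subr_lt0// add0r.
  + by rewrite sr eqxx in rs.
Qed.

Let X_gb s : 0 <= s <= 1 ->
  \int[Pr]_w (X w * gb (Psi s w)) = \int[mu]_x (chi x * gb x) - fwd s.
Proof.
move=> s01; have /andP[s0 s1] := s01.
rewrite (fwdE s01); under eq_Rintegral do rewrite mulrC.
have s10 : 0 <= 1 - s by rewrite subr_ge0.
have := stationary_correlation s0 s10 mgb mchi gb_sq chi_mu (fun x => chiP x s10).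
rewrite (_ : s + (1 - s) = 1) => [->|]; last by rewrite addrC subrK.
rewrite (correlation_corrector mgb gb_sq s10); congr (_ - _).
by apply: eq_Rintegral => x _; rewrite mulrC.
Qed.

Lemma Rintegral_X_occ_occ2 :
  2 * \int[Pr]_w (X w * occ w) + \int[Pr]_w (occ w ^+ 2) =
  2 * \int[mu]_x (chi x * gb x).
Proof.
have [fi bi fb] := fwd_bwd; set S := \int[mu]_x (chi x * gb x).
have eX : \int[Pr]_w (X w * occ w) = S - \int[leb]_(s in `[0, 1]) fwd s.
  rewrite (Rintegral_occupation (mchiPsi ler01) (ichiPsi ler01)).
  have iS := integrable_cst_itv (1 : R) S.
  transitivity (\int[leb]_(s in I01) (cst S s - fwd s)).
    by apply: eq_Rintegral => s; rewrite inE /= in_itv/= => s01; rewrite X_gb.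
  by rewrite (RintegralB mI01 iS fi) (Rintegral_cst leb mI01) leb1 mulr1.
have eO : \int[Pr]_w (occ w ^+ 2) =
    \int[leb]_(s in `[0, 1]) fwd s + \int[leb]_(s in `[0, 1]) bwd s.
  rewrite (Rintegral_occupation mocc iocc) -(RintegralD mI01 fi bi).
  by apply: eq_Rintegral => s; rewrite inE /= in_itv/= => s01; rewrite occ_gb.
have cancel (x o f b : R) : x = S - f -> o = f + b -> f = b -> 2 * x + o = 2 * S.
  by move=> -> -> ->; ring.
exact: cancel eX eO fb.
Qed.

(** The increment [X - Y + I] is orthogonal to the initial value: the integral of [rho chi] over
    [[0, 1]] is lost in the first term, by the formula for [P 1 chi], and regained in the second. *)
Lemma Rintegral_Y_X_occ :
  \int[Pr]_w (Y w * X w) + \int[Pr]_w (Y w * occ w) = \int[mu]_x (chi x ^+ 2).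
Proof.
have -> : \int[Pr]_w (Y w * occ w) = \int[leb]_(s in `[0, 1]) rho chi s.
  rewrite (Rintegral_occupation (mchiPsi (lexx 0)) (ichiPsi (lexx 0))).
  apply: eq_Rintegral => s; rewrite inE /= in_itv/= => /andP[s0 s1].
  have := stationary_correlation (lexx 0) s0 mchi mgb chi_mu gb_sq (gbP _).
  by rewrite add0r => ->.
have := stationary_correlation (lexx 0) ler01 mchi mchi chi_mu chi_mu (fun x => chiP x ler01).
rewrite add0r => ->; rewrite (correlation_corrector mchi chi_mu ler01) subrK.
by apply: eq_Rintegral => x _; rewrite expr2.
Qed.

Lemma variance_corrector :
  (\int[Pr]_w ((X w - Y w + occ w) ^+ 2)%:E)%E = (2 * \int[mu]_x (chi x * gb x))%:E.
Proof.
have mX := mchiPsi ler01; have mY := mchiPsi (lexx 0).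
have iX2 := chiPsi2 ler01; have iY2 := chiPsi2 (lexx 0).
have io2 : Pr.-integrable setT (EFin \o (fun w => occ w ^+ 2)) by exact: integrable_occupation.
have iXo := integrable_occupation mX (ichiPsi ler01).
have iYo := integrable_occupation mY (ichiPsi (lexx 0)).
have iYX : Pr.-integrable setT (EFin \o (fun w => Y w * X w)) by exact: integrable_mul_sqr.
have iA : Pr.-integrable setT (EFin \o (fun w => X w ^+ 2 + Y w ^+ 2)).
  exact: (integrableD measurableT iX2 iY2).
have iB : Pr.-integrable setT (EFin \o (fun w => 2 * (X w * occ w) + occ w ^+ 2)).
  exact: (integrableD measurableT (integrableZl measurableT 2 iXo) io2).
have iC : Pr.-integrable setT (EFin \o (fun w => Y w * X w + Y w * occ w)).
  exact: (integrableD measurableT iYX iYo).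
have iC2 : Pr.-integrable setT (EFin \o (fun w => 2 * (Y w * X w + Y w * occ w))).
  exact: (integrableZl measurableT 2 iC).
have i2Xo : Pr.-integrable setT (EFin \o (fun w => 2 * (X w * occ w))).
  exact: (integrableZl measurableT 2 iXo).
have iAB : Pr.-integrable setT (EFin \o (fun w =>
    (X w ^+ 2 + Y w ^+ 2) + (2 * (X w * occ w) + occ w ^+ 2))).
  exact: (integrableD measurableT iA iB).
have iABC : Pr.-integrable setT (EFin \o (fun w =>
    (X w ^+ 2 + Y w ^+ 2) + (2 * (X w * occ w) + occ w ^+ 2) -
    2 * (Y w * X w + Y w * occ w))).
  exact: (integrableB measurableT iAB iC2).
(* The square is grouped so that, after the squares of [X] and [Y], its blocks are the left-hand
   sides of the two preceding identities. *)
under eq_integral => w _.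
  rewrite (_ : (X w - Y w + occ w) ^+ 2 =
    (X w ^+ 2 + Y w ^+ 2) + (2 * (X w * occ w) + occ w ^+ 2) -
    2 * (Y w * X w + Y w * occ w)); last by ring.
  over.
rewrite -[LHS]fineK; last exact: (integrable_fin_num measurableT iABC).
congr EFin; rewrite -/(Rintegral _ _ _) (RintegralB measurableT iAB iC2).
rewrite (RintegralD measurableT iA iB) (RintegralD measurableT iX2 iY2).
rewrite (RintegralD measurableT i2Xo io2) (RintegralZl 2 measurableT iC) (RintegralD measurableT iYX iYo).
rewrite (RintegralZl 2 measurableT iXo) Rintegral_X_occ_occ2 Rintegral_Y_X_occ.
have law2 s (s0 : 0 <= s) := @Rintegral_law _ _ _ _ _ Pr mu (Psi s) (mPsi s0)
  (fun A mA => stationary_law s0 mA) _ chi_mu.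
by rewrite /X /Y !law2//; ring.
Qed.

End Variance.

(** * Consequences of the hypotheses on the semigroup *)

Section Polish.
Context {R : realType} {d : measure_display} {E : measurableType d}.
Variable rho : E -> E -> R.
Hypotheses (pm : polish_metric rho) (bor : borel_of rho).

Lemma rho_continuous_measurable (f : E -> R) : rho_continuous rho f ->
  measurable_fun setT f.
Proof.
move=> cf mT; apply: (measurability _ (RGenOInfty.measurableE R)) => //.
move=> /= _ [_ [a ->] <-]; rewrite setTI bor; apply: sub_sigma_algebra.
move=> x /=; rewrite in_itv/= andbT => ax.
have e0 : 0 < f x - a by rewrite subr_gt0.
have [r r0 H] := cf x _ e0; exists r => // y /= /H.
by rewrite in_itv/= andbT ltr_norml => /andP[_]; lra.
Qed.

Lemma lip_b_rho_continuous (f : E -> R) : lip_b rho f -> rho_continuous rho f.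
Proof.
move=> [L [Lb Ll]] x e e0.
have L0 : 0 <= L by exact: le_trans (Lb x).
exists (e / (L + 1)) => [|y]; first by rewrite divr_gt0// ltr_wpDl.
rewrite ltr_pdivlMr ?ltr_wpDl// => xy; apply: le_lt_trans (Ll x y) _.
have [[rho0 _ _ _] _ _] := pm; have := rho0 x y; nra.
Qed.

(* [L + 1] rather than [L] because [L] may be [0]. *)
Lemma dFM_lip (m1 m2 : {measure set E -> \bar R}) (f : E -> R) (L c : R) :
  m1 setT = 1%E -> m2 setT = 1%E ->
  (forall x, `|f x| <= L) -> (forall x y, `|f x - f y| <= L * rho x y) ->
  (dFM rho m1 m2 <= c%:E)%E ->
  `|\int[m1]_x f x - \int[m2]_x f x| <= (L + 1) * c.
Proof.
move=> m11 m21 fL fl mc.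
have L0 : 0 <= L by exact: le_trans (fL point).
have L1 : 0 < L + 1 by rewrite ltr_wpDl.
have [[rho0 _ _ _] _ _] := pm.
pose q x := (L + 1)^-1 * f x.
have mf : measurable_fun setT f.
  by apply/rho_continuous_measurable/lip_b_rho_continuous; exists L.
have i1 := bounded_integrable m11 mf fL; have i2 := bounded_integrable m21 mf fL.
have qBL : BL1 rho q.
  split=> [x|x y]; rewrite /q -?mulrBr normrM gtr0_norm ?invr_gt0// mulrC ler_pdivrMr//.
    by rewrite mul1r (le_trans (fL x))// lerDl.
  by apply: (le_trans (fl x y)); have := rho0 x y; nra.
have iq (m : {measure set E -> \bar R}) : m setT = 1%E -> m.-integrable setT (EFin \o f) ->
  (\int[m]_x (q x)%:E = ((L + 1)^-1 * \int[m]_x f x)%:E)%E.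
  move=> _ mi; rewrite -RintegralZl// /Rintegral fineK//; apply: integrable_fin_num => //.
  exact: (integrableZl measurableT _ mi).
have : (`|\int[m1]_x (q x)%:E - \int[m2]_x (q x)%:E| <= c%:E)%E.
  by apply: le_trans mc; apply: ereal_sup_ubound; exists q.
rewrite (iq m1)// (iq m2)// -EFinB lee_fin -mulrBr normrM gtr0_norm ?invr_gt0//.
by rewrite mulrC ler_pdivrMr// mulrC.
Qed.
End Polish.

(* [U] is truncated at level [N] because its [mu]-integrability is not known
   beforehand; then [t -> +oo]. *)
Lemma invariant_lyapunov {R : realType} {d : measure_display} {E : measurableType d}
    (P : R -> R.-pker E ~> E) (mu : probability E R) (U : E -> R) (A B Gamma : R) :
  (forall t, 0 <= t -> is_mix mu (P t) mu) ->
  measurable_fun setT U -> (forall x, 0 <= U x) ->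
  0 <= A -> 0 <= B -> 0 < Gamma ->
  (forall x t, 0 <= t -> (\int[P t x]_y (U y)%:E <=
     (A * expR (- (Gamma * t)) * U x + B)%:E)%E) ->
  (\int[mu]_x (U x)%:E <= B%:E)%E.
Proof.
move=> inv mU U0 A0 B0 Ga0 UP.
have mu1 : mu setT = 1%E by exact: probability_setT.
pose T (N : nat) (y : R) := Num.min y N%:R.
have T0 N y : 0 <= y -> 0 <= T N y by move=> y0; rewrite /T le_min y0 ler0n.
have TN N y : 0 <= y -> `|T N y| <= N%:R.
  by move=> y0; rewrite ger0_norm ?T0// /T ge_min lexx orbT.
have mT N (h : E -> R) : measurable_fun setT h -> measurable_fun setT (T N \o h).
  by move=> mh; apply: measurable_minr => //; exact: measurable_cst.
have key N : \int[mu]_x T N (U x) <= B.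
  pose a (n : nat) x := A * expR (- (Gamma * n%:R)) * U x.
  have a0 n x : 0 <= a n x by rewrite !mulr_ge0// expR_ge0.
  have ma n : measurable_fun setT (a n) by exact: measurable_funM.
  have iT (h : E -> R) : measurable_fun setT h -> (forall x, 0 <= h x) ->
      mu.-integrable setT (EFin \o (T N \o h)).
    by move=> mh h0; apply: (bounded_integrable mu1 (mT N h mh)) => x; exact: TN.
  have iTP t x : (P t x).-integrable setT (EFin \o (T N \o U)).
    by apply: (@bounded_integrable _ _ _ (P t x) (prob_kernel x) _ N%:R (mT N U mU)) => y; exact: TN.
  (* Invariance replaces [T N U] by [P n (T N U)], which is at most
     [min (a n + B) N <= B + T N (a n)]. *)
  have step n : \int[mu]_x T N (U x) <= B + \int[mu]_x T N (a n x).
    have n0 : 0 <= n%:R :> R by [].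
    rewrite (@Rintegral_kernel _ _ _ _ _ (P n%:R) mu mu (inv _ n0) (T N \o U))//; last exact: iT.
    have iB : mu.-integrable setT (EFin \o cst B).
      by apply: (@bounded_integrable _ _ _ mu mu1 _ `|B|) => //; exact: measurable_cst.
    have -> : B + \int[mu]_x T N (a n x) = \int[mu]_x (cst B x + T N (a n x)).
      rewrite (RintegralD measurableT iB (iT (a n) (ma n) (a0 n))); congr (_ + _).
      rewrite Rintegral_cst// -[LHS]mulr1; congr (_ * _).
      exact/esym/(congr1 fine mu1).
    apply: le_Rintegral => //.
    - exact: (@integrable_kernel _ _ _ _ _ (P n%:R) mu mu (inv _ n0) (T N \o U) (iT U mU U0)).
    - exact: (integrableD measurableT iB (iT (a n) (ma n) (a0 n))).
    move=> x _.
    have bN : \int[P n%:R x]_y T N (U y) <= N%:R.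
      apply: le_trans (ler_norm _) _.
      apply: (@normr_Rintegral_le _ _ _ (P n%:R x) (prob_kernel x) _ N%:R (mT N U mU)) => y; exact: TN.
    have bU : \int[P n%:R x]_y T N (U y) <= a n x + B.
      rewrite -lee_fin /Rintegral fineK; last exact: integrable_fin_num.
      apply: le_trans (UP x _ n0); apply: ge0_le_integral => //.
      - by move=> y _; rewrite lee_fin T0.
      - by apply/measurable_EFinP; exact: mT.
      - exact/measurable_EFinP.
      - by move=> y _; rewrite lee_fin /T ge_min lexx.
    rewrite /T; case: (leP (a n x) N%:R) => aN /=; first by rewrite addrC.
    by apply: (le_trans bN); rewrite lerDr.
  (* [a n x] decays geometrically at each [x], and the truncation level is the dominating
     constant. *)
  have cv : B + \int[mu]_x T N (a n x) @[n --> \oo] --> B + \int[mu]_x (cst 0 x).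
    apply: cvgD; first exact: cvg_cst.
    apply: (@Rintegral_dominated_cvg _ _ _ mu (fun n x => T N (a n x)) (cst 0) (cst N%:R)).
    - by move=> n; exact: mT.
    - by apply: (@bounded_integrable _ _ _ mu mu1 _ N%:R) => [|x]; [exact: measurable_cst|rewrite ger0_norm].
    - by move=> n x; exact: TN.
    - move=> x; apply: (@squeeze_cvgr _ _ _ _ (cst 0) (a ^~ x)).
      + by apply: nearW => n; rewrite T0//= /T ge_min lexx.
      + exact: cvg_cst.
      + have -> : a ^~ x = (fun n => A * U x * expR (- Gamma) ^+ n).
          by apply/funext => n; rewrite /a -expRM_natl mulrN mulrC (mulrC n%:R); ring.
        rewrite -[X in _ --> X](mulr0 (A * U x)); apply: cvgM; first exact: cvg_cst.
        apply: cvg_expr; rewrite ger0_norm ?expR_ge0// -expR0 ltr_expR.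
        by rewrite oppr_lt0.
  rewrite Rintegral_cst// mul0r addr0 in cv.
  by apply: (cvgr_to_ge cv); apply: nearW.
(* The bound by [B] is uniform in [N], so monotone convergence removes the truncation. *)
have -> : (\int[mu]_x (U x)%:E = \int[mu]_x limn (fun N => (T N (U x))%:E))%E.
  apply: eq_integral => x _; apply/esym/cvg_lim => //.
  apply: cvg_near_cst; exists (Num.truncn (U x)).+1 => // N /= UN.
  rewrite /T; congr EFin; apply/min_idPl.
  apply: ltW; apply: lt_le_trans (truncnS_gt _) _; by rewrite ler_nat.
have mTE n : measurable_fun setT (fun x => (T n (U x))%:E).
  by apply/measurable_EFinP; exact: mT.
have T0E n x : setT x -> (0 <= (T n (U x))%:E)%E by move=> _; rewrite lee_fin T0.
have ndT x : setT x -> {homo (fun N => (T N (U x))%:E) : n m / (n <= m)%N >-> (n <= m)%E}.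
  move=> _ n p np; rewrite lee_fin /T le_min !ge_min lexx /=.
  by rewrite ler_nat np orbT.
have cv := @cvg_monotone_convergence _ _ _ mu _ measurableT _ mTE T0E ndT.
rewrite -(cvg_lim _ cv)//; apply: lime_le; first by apply/cvg_ex; eexists; exact: cv.
apply: nearW => N; have := key N; rewrite -lee_fin /Rintegral fineK//.
apply: integrable_fin_num => //; apply: (bounded_integrable mu1 (mT N U mU)) => x; exact: TN.
Qed.

Theorem theorem4p1 (R : realType) (d : measure_display) (E : measurableType d)
  (rho : E -> E -> R)
  (dO : measure_display) (Om : measurableType dO) (Pr : probability Om R)
  (Psi : R -> Om -> E) (P : R -> R.-pker E ~> E)
  (mu : probability E R) (V : E -> R) (g : E -> R) :
  polish_metric rho -> borel_of rho ->
  markov_process Pr Psi P ->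
  (* the process is started from mu *)
  (forall A, measurable A -> Pr (Psi 0 @^-1` A) = mu A) ->
  rho_continuous rho V -> (forall x, 0 <= V x) ->
  (* (a) unique invariant probability measure mu and exponential FM-ergodicity *)
  (forall t, 0 <= t -> is_mix mu (P t) mu) ->
  (forall nu : probability E R, (forall t, 0 <= t -> is_mix nu (P t) nu) ->
     forall A, measurable A -> nu A = mu A) ->
  (exists (gamma kappa : R) (C : (set E -> \bar R) -> R),
     [/\ 0 < gamma, 0 < kappa,
         forall nu : probability E R,
           (integral nu setT (fun x => (V x)%:E) < +oo)%E ->
           0 <= C nu /\
           forall t (nuP : {measure set E -> \bar R}), 0 <= t ->
             is_mix nu (P t) nuP ->
             (dFM rho nuP mu <= (C nu * expR (- (gamma * t)))%:E)%E &
         forall x, C (\d_x) = kappa * Num.sqrt (V x + 1)]) ->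
  (* (b) Lyapunov-type bound for V^2 *)
  (exists (A B Gamma : R), [/\ 0 <= A, 0 <= B, 0 < Gamma &
     forall x t, 0 <= t ->
       (integral (P t x) setT (fun y => (V y ^+ 2)%:E)
         <= (A * expR (- (Gamma * t)) * V x ^+ 2 + B)%:E)%E]) ->
  (* g *)
  lip_b rho g ->
  (forall x, exists2 delta : R, 0 < delta &
     {within `[0, delta[, continuous (fun t => Pf P t g x)}) ->
  let gbar := fun x => g x - Rintegral mu setT g in
  let chi := fun x => Rintegral (@lebesgue_measure R) `[0, +oo[
                        (fun t => Pf P t gbar x) in
  let M1 := fun w => chi (Psi 1 w) - chi (Psi 0 w)
                     + Rintegral (@lebesgue_measure R) `[0, 1]
                         (fun s => gbar (Psi s w)) in
  let sigma2 := integral Pr setT (fun w => (M1 w ^+ 2)%:E) in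
  (exists hchi, gen_value mu P chi hchi) /\
  forall hchi, gen_value mu P chi hchi ->
    sigma2 = ((-2)%:E * integral mu setT (fun x => (chi x * hchi x)%:E))%E /\
    sigma2 = (2%:E * integral mu setT (fun x => (chi x * gbar x)%:E))%E.
Proof.
move=> pm bor mk init cV V0 inv _ [ga [kap [C [ga0 kap0 erg Cdelta]]]]
  [A [B [Gamma [A0 B0 Gamma0 lyap]]]] lg gcont gbar chi M1 sigma2.
have mu1 : mu setT = 1%E by exact: probability_setT.
have P1 t x : P t x setT = 1%E by exact: prob_kernel.
have PS : transition_semigroup P by case: mk.
have mV := rho_continuous_measurable bor cV.
have mg := rho_continuous_measurable bor (lip_b_rho_continuous pm lg).
have [L [gL gLip]] := lg.
have L0 : 0 <= L by exact: le_trans (gL point).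
pose c := Rintegral mu setT g.
have mgb : measurable_fun setT gbar by apply: measurable_funB.
have gbM x : `|gbar x| <= L + L.
  apply: (le_trans (ler_normB _ _)); apply: lerD => //; exact: normr_Rintegral_le.
have PfgB t x : Pf P t gbar x = Pf P t g x - c.
  have ic : (P t x).-integrable setT (EFin \o cst c).
    by apply: (@bounded_integrable _ _ _ (P t x) (P1 t x) _ `|c|) => //; exact: measurable_cst.
  have ig : (P t x).-integrable setT (EFin \o g).
    exact: (@bounded_integrable _ _ _ (P t x) (P1 t x) _ L).
  rewrite /Pf (RintegralB measurableT ig ic); congr (_ - _).
  rewrite Rintegral_cst// -[RHS]mulr1; congr (_ * _).
  exact: (congr1 fine (P1 t x)).
have Pfg0 x : Pf P 0 g x = g x by apply: Pf0.
have gb0 x : Pf P t gbar x @[t --> 0^'+] --> gbar x.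
  under eq_fun do rewrite PfgB.
  apply: cvgB; last exact: cvg_cst.
  have [del del0 cont] := gcont x.
  (* Halving the interval gives a closed segment, on which continuity is characterised by one-sided
     limits at the ends. *)
  have cont2 : {within `[0, del / 2], continuous (fun t => Pf P t g x)}.
    apply: continuous_subspaceW cont => t /=; rewrite !in_itv/= => /andP[-> /=]; lra.
  have del20 : 0 < del / 2 by lra.
  by have [_ + _] := (continuous_within_itvP _ del20).1 cont2; rewrite Pfg0.
(* [L + 1] is the cost of normalising [g] to a test function of the metric on measures; the rest is
   [C (\d_x)]. *)
pose w x := (L + 1) * kap * Num.sqrt (V x + 1).
have mw : measurable_fun setT w.
  have msqrt : measurable_fun setT (@Num.sqrt R).
    by apply: continuous_measurable_fun => y; exact: sqrt_continuous.
  apply: measurable_funM => //; apply: (measurableT_comp msqrt).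
  exact: measurable_funD.
have Gw t x : 0 <= t -> `|Pf P t gbar x| <= w x * expR (- (ga * t)).
  move=> t0; rewrite PfgB.
  (* Ergodicity is applied to the Dirac mass at [x], whose image under the semigroup is [P t x]. *)
  pose nu : probability E R := \d_x.
  have nuV : (\int[nu]_y (V y)%:E < +oo)%E.
    rewrite integral_dirac//; last exact/measurable_EFinP.
    by rewrite diracT mul1e ltry.
  have [_ /(_ t (P t x) t0) H] := erg nu nuV.
  have mixx : is_mix nu (P t) (P t x).
    move=> S mS; rewrite integral_dirac//; last exact: measurable_kernel.
    by rewrite diracT mul1e.
  have := dFM_lip pm bor (P1 t x) mu1 gL gLip (H mixx).
  by rewrite (Cdelta x) /w !mulrA.
have sV1 x : Num.sqrt (V x + 1) ^+ 2 = V x + 1 by rewrite sqr_sqrtr// addr_ge0.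
(* [w^2] is a constant times [V + 1], and [V + 1 <= V^2 + 2]. *)
have w2i (m : {measure set E -> \bar R}) : m setT = 1%E ->
    (\int[m]_x (V x ^+ 2)%:E < +oo)%E -> m.-integrable setT (EFin \o (fun x => w x ^+ 2)).
  move=> m1 mVoo.
  have iV : m.-integrable setT (EFin \o (fun x => V x ^+ 2)).
    apply/integrableP; split; first by apply/measurable_EFinP; exact: measurable_funX.
    by under eq_integral do rewrite /= ger0_norm ?sqr_ge0//.
  have i2 : m.-integrable setT (EFin \o cst 2).
    apply: (@bounded_integrable _ _ _ m m1 _ 2) => [|x]; first exact: measurable_cst.
    by rewrite ger0_norm.
  have := integrableZl measurableT (((L + 1) * kap) ^+ 2) (integrableD measurableT iV i2).
  apply: le_integrable => //; first by apply/measurable_EFinP; exact: measurable_funX.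
  move=> x _ /=; rewrite lee_fin /w exprMn sV1 !normrM ler_wpM2l//.
  rewrite !ger0_norm ?addr_ge0 ?sqr_ge0//; have := sqr_ge0 (V x - 1); nra.
have wP t x : 0 <= t -> (P t x).-integrable setT (EFin \o (fun x => w x ^+ 2)).
  by move=> t0; apply: w2i => //; apply: le_lt_trans (lyap x t t0) _; rewrite ltry.
have wmu : mu.-integrable setT (EFin \o (fun x => w x ^+ 2)).
  apply: w2i => //; apply: (@le_lt_trans _ _ B%:E); last by rewrite ltry.
  apply: (invariant_lyapunov inv _ _ A0 B0 Gamma0 lyap); first exact: measurable_funX.
  by move=> x; exact: sqr_ge0.
have mG := Pf_jointly_measurable PS mgb gbM gb0.
have mchi : measurable_fun setT chi := corrector_measurable PS mgb gbM gb0 ga0 mw Gw wmu.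
have chi_le x := corrector_le PS mgb gbM gb0 ga0 Gw x.
have Pf_chi s x (s0 : 0 <= s) := Pf_corrector PS mgb gbM gb0 ga0 mw Gw wP x s0.
have chi2i (m : {measure set E -> \bar R}) : m.-integrable setT (EFin \o (fun x => w x ^+ 2)) ->
    m.-integrable setT (EFin \o (fun x => chi x ^+ 2)).
  move=> mwi.
  have := integrableZl measurableT ((\int[lebesgue_measure]_(t in `[0, +oo[) expR (- (ga * t))) ^+ 2) mwi.
  apply: le_integrable => //; first by apply/measurable_EFinP; exact: measurable_funX.
  move=> x _ /=; rewrite lee_fin -exprMn !normrX lerXn2r ?nnegrE//.
  by apply: (le_trans (chi_le x)); rewrite mulrC ler_norm.
have chi_mu := chi2i _ wmu.
have chi_P t x (t0 : 0 <= t) := chi2i _ (wP t x t0).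
have gb00 x := Pf0 PS mgb x.
have var : sigma2 = (2 * \int[mu]_x (chi x * gbar x))%:E.
  exact: (variance_corrector mk init inv mgb gbM mG mchi chi_mu chi_P Pf_chi).
split.
  by exists (fun x => - gbar x); exact: (gen_value_chi mgb gbM gb0 gb00 mG mchi chi_mu chi_P Pf_chi).
move=> hchi gh; rewrite var; split.
  rewrite (integral_gen_value mgb gbM gb0 gb00 mG mchi chi_mu Pf_chi gh).
  by rewrite -EFinN -EFinM mulrNN.
rewrite EFinM /Rintegral fineK//; apply: integrable_fin_num => //.
apply: integrable_mul_sqr => //.
apply: (@bounded_integrable _ _ _ mu mu1 _ ((L + L) ^+ 2)); first exact: measurable_funX.
by move=> x; rewrite normrX lerXn2r ?nnegrE// addr_ge0.
Qed.
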